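(* Let $d\ge2$ and let $z_1,\dots,z_n$, with $z_i(t)\in\mathbb{R}^d$, be governed by $$\dot{z}_i = \sum_{j \in \mathcal{N}_i(t)}f_{ij}\left(\left\|\frac{z_j}{\|z_j\|} - \frac{z_i}{\|z_i\|}\right\|\right)\frac{\|z_i\|}{\|z_j\|}(z_j - z_i),\qquad z_i(0)=z_{i0},\quad i=1,\dots,n.$$ Suppose that none of the initial states $z_{i0}$ equals zero, and let $y_i(t)=z_i(t)/\|z_i(t)\|$. Then on the time interval $[0,\infty)$ the dynamics of the $y_i$'s is given by $$\dot{y}_i = (I - y_iy_i^T)\sum_{j \in \mathcal{N}_i(t)}f_{ij}(\|y_j - y_i\|)(y_j - y_i),\qquad i=1,\dots,n.$$
   Context: $\|\cdot\|$ is the Euclidean norm. Weights: each $f_{ij}:\mathbb{R}\to\mathbb{R}$ is Lipschitz and attains positive values for positive arguments. Time-varying graphs: the node set is $\mathcal{V}=\{1,\dots,n\}$. Each neighborhood $\mathcal{N}_i(t)\subset\mathcal{V}$ is a piecewise constant, right-continuous set-valued function of $t\in\mathbb{R}$; there is $\tau_D>0$ such that for every $i$ consecutive discontinuity times $\tau_{ik}$ of $\mathcal{N}_i$ satisfy $\inf_k(\tau_{i(k+1)}-\tau_{ik})>\tau_D$. The graph is $\mathcal{G}(t)=(\mathcal{V},\mathcal{E}(t))$ with $(i,j)\in\mathcal{E}(t)$ iff $j\in\mathcal{N}_i(t)$. Node $i$ is connected to $j$ if there is a directed path from $i$ to $j$. A directed graph is quasi-strongly connected if there is at least one node to which all other nodes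 are connected. The union graph is $\mathcal{G}([t_1,t_2))=(\mathcal{V},\bigcup_{t\in[t_1,t_2)}\mathcal{E}(t))$. $\mathcal{G}(t)$ is uniformly quasi-strongly connected if there is $T>0$ such that $\mathcal{G}([t,t+T))$ is quasi-strongly connected for all $t$. Standing assumption: $\mathcal{G}(t)$ is uniformly quasi-strongly connected. Solutions are continuous and satisfy the differential equations except at switching times of the graph. *)

(* Defs.v *)
From HB Require Import structures.
From mathcomp Require Import all_boot all_order all_algebra.
From mathcomp Require Import all_classical all_reals all_analysis.

Set Implicit Arguments.
Unset Strict Implicit.
Unset Printing Implicit Defensive.

Import Order.TTheory GRing.Theory Num.Theory.
Import numFieldNormedType.Exports.

Local Open Scope classical_set_scope.
Local Open Scope ring_scope.

(* The library norm `|v| on column vectors is the sup norm, hence this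
   definition; the two norms induce the same topology, so limits and continuity
   below use the library structure on 'cV[R]_d. *)
Definition euclid_norm (R : realType) (d : nat) (v : 'cV[R]_d) : R :=
  Num.sqrt (\sum_k v k 0 ^+ 2).

Definition unit_vec (R : realType) (d : nat) (v : 'cV[R]_d) : 'cV[R]_d :=
  (euclid_norm v)^-1 *: v.

Definition weights (R : realType) (n : nat) (f : 'I_n -> 'I_n -> R -> R) : Prop :=
  forall i j, lipschitz (f i j) /\ forall r, 0 < r -> 0 < f i j r.

Section Graphs.
Variables (R : realType) (n : nat).

(* Discontinuity in the sense of the discrete topology on subsets of nodes. *)
Definition discontinuity (Ni : R -> {set 'I_n}) : set R :=
  [set t | ~ \forall s \near t, Ni s = Ni t].

(* On an interval free of discontinuities Ni is locally constant, hence
   constant. *)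
Definition piecewise_constant (Ni : R -> {set 'I_n}) : Prop :=
  forall a b : R, finite_set (discontinuity Ni `&` `[a, b]).

Definition right_continuous (Ni : R -> {set 'I_n}) : Prop :=
  forall t, \forall s \near t^'+, Ni s = Ni t.

Definition consecutive (A : set R) (s t : R) : Prop :=
  [/\ A s, A t, s < t & forall r, s < r < t -> ~ A r].

(* The infimum is +oo when there are fewer than two discontinuities. *)
Definition dwell_time (Ni : R -> {set 'I_n}) : \bar R :=
  ereal_inf [set g | exists s t,
    consecutive (discontinuity Ni) s t /\ g = (t - s)%:E].

Definition time_varying_neighborhoods (N : 'I_n -> R -> {set 'I_n}) : Prop :=
  (forall i, piecewise_constant (N i) /\ right_continuous (N i)) /\
  exists2 tauD : R, 0 < tauD & forall i, (tauD%:E < dwell_time (N i))%E.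

Definition switching_time (N : 'I_n -> R -> {set 'I_n}) (t : R) : Prop :=
  exists i, discontinuity (N i) t.

(* Edges of the union of the graphs over [t1, t2). *)
Definition union_graph (N : 'I_n -> R -> {set 'I_n}) (t1 t2 : R) : rel 'I_n :=
  fun i j => `[< exists2 t, t1 <= t < t2 & j \in N i t >].

Definition quasi_strongly_connected (e : rel 'I_n) : Prop :=
  exists j, forall i, connect e i j.

Definition uniformly_quasi_strongly_connected
    (N : 'I_n -> R -> {set 'I_n}) : Prop :=
  exists2 T : R, 0 < T &
    forall t, quasi_strongly_connected (union_graph N t (t + T)).

End Graphs.

Section Dynamics.
Variables (R : realType) (n d : nat).

(* A system of coupled equations: the neighborhoods of all nodes and the states
   of all nodes determine the velocity of each node. *)
Definition vector_field : Type :=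
  ('I_n -> {set 'I_n}) -> ('I_n -> 'cV[R]_d) -> 'I_n -> 'cV[R]_d.

Definition lifted_field (f : 'I_n -> 'I_n -> R -> R) : vector_field :=
  fun N z i => \sum_(j in N i)
    (f i j (euclid_norm (unit_vec (z j) - unit_vec (z i)))
      * (euclid_norm (z i) / euclid_norm (z j))) *: (z j - z i).

Definition sphere_field (f : 'I_n -> 'I_n -> R -> R) : vector_field :=
  fun N y i => (1%:M - y i *m (y i)^T) *m
    \sum_(j in N i) f i j (euclid_norm (y j - y i)) *: (y j - y i).

Definition time_interval (b : \bar R) : set R :=
  [set t | 0 <= t /\ (t%:E < b)%E].

(* Derivative relative to A: for A = time_interval b this is the right
   derivative at t = 0 and the ordinary derivative at the other points of A. *)
Definition has_derivative_within (A : set R) (x : R -> 'cV[R]_d) (t : R)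
    (v : 'cV[R]_d) : Prop :=
  (s - t)^-1 *: (x s - x t) @[s --> within A t^'] --> v.

(* Only the restriction of x to time_interval b = [0, b) is relevant. *)
Definition solution (N : 'I_n -> R -> {set 'I_n}) (F : vector_field)
    (b : \bar R) (x : 'I_n -> R -> 'cV[R]_d) : Prop :=
  [/\ (0 < b)%E,
      forall i, {within time_interval b, continuous (x i)}
    & forall i t, time_interval b t -> ~ switching_time N t ->
        has_derivative_within (time_interval b) (x i) t
          (F (N^~ t) (x^~ t) i)].

(* A solution on [0, b) that is not the restriction of a solution on a longer
   interval. *)
Definition maximal_solution (N : 'I_n -> R -> {set 'I_n}) (F : vector_field)
    (b : \bar R) (x : 'I_n -> R -> 'cV[R]_d) : Prop :=
  solution N F b x /\
  forall (c : \bar R) (w : 'I_n -> R -> 'cV[R]_d), solution N F c w ->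
    (forall i t, time_interval b t -> w i t = x i t) -> (c <= b)%E.

End Dynamics.

(* Main.v *)
Require Import Defs.
From HB Require Import structures.
From mathcomp Require Import all_boot all_order all_algebra.
From mathcomp Require Import all_classical all_reals all_analysis.
From mathcomp Require Import ring lra.
Import Order.TTheory GRing.Theory Num.Theory.
Import numFieldNormedType.Exports.
Local Open Scope classical_set_scope.
Local Open Scope ring_scope.

(** Write [rho i t] for the squared norm of [z i t], and think of the first time
    at which the smallest norm has decayed too much. At that time the quotients
    |z_i| / |z_j|, for the node [i] whose norm is smallest, are at most 1, so that
    the inward speed of node [i] is at most a constant times |z_i|: the weights
    are bounded on [0, 2], where the distances of points of the unit sphere lie.
    Hence the smallest norm decays at most exponentially, and no node reaches the
    origin ([norm_lower], [solution_neq0]). The weights being nonnegative on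
    [0, 2], the radial growth rate of every node is bounded, so the largest norm
    grows at most exponentially ([norm_upper]). Both arguments are instances of
    the comparison principle [first_passage], and the derivatives are needed only
    just before the time under consideration ([smaller_before]); switching times,
    being isolated ([switching_time_isolated]), do not matter.

    Suppose that the interval of existence were [0, b) with [b] finite. The two
    bounds make the velocities bounded, so the states have limits at [b], and the
    limits are nonzero ([limit_at_end]). Near nonzero states the field is
    Lipschitz ([lifted_field_loc_lipschitz]), and the graph is constant for some
    time after [b]; Picard's iteration ([picard]) then continues the solution
    past [b] ([trajectory_extension], [finite_end_extension]), against
    maximality. If [b] is not a switching time the continuation has to satisfy
    the equation at [b] too: its left derivative there is the limit of the
    derivatives ([left_derivative_limit]).

    The equation for the directions is the derivative of z / |z|: the projection
    orthogonal to y_i, applied to the velocity divided by |z_i|, kills the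
    multiple of y_i by which that vector differs from the sum of the
    f_ij (y_j - y_i) ([has_derivative_within_unit_vec],
    [sphere_field_unit_vec]). *)

(** * Local existence for ordinary differential equations *)

Lemma lipschitz_continuous {R : realType} (g : R -> R) (k : R) :
  (forall s t, `|g s - g t| <= k * `|s - t|) -> continuous g.
Proof.
move=> glip t; have k1 : 0 < k + 1.
  have := le_trans (normr_ge0 _) (glip 1 0); rewrite subr0 normr1 mulr1.
  by move=> ?; lra.
apply/(@cvgrPdist_le R R^o) => e e0; near=> s.
have h : `|t - s| <= e / (k + 1).
  near: s; apply: (@cvgr_dist_le _ _ _ _ _ idfun t); first exact: cvg_id.
  exact: divr_gt0.
apply: (le_trans (glip _ _)); apply: (@le_trans _ _ ((k + 1) * `|t - s|)).
  by apply: ler_wpM2r => //; lra.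
by rewrite mulrC -ler_pdivlMr.
Unshelve. all: by end_near. Qed.

(** The primitive of [g] that vanishes at [a]; the integral starts at [a - 1] so
    that the primitive is also differentiable at [a]. *)
Definition primitive {R : realType} (a : R) (g : R -> R) (t : R) : R :=
  \int[lebesgue_measure]_(r in `[a - 1, t]) g r
  - \int[lebesgue_measure]_(r in `[a - 1, a]) g r.

Lemma primitive_start {R : realType} (a : R) (g : R -> R) : primitive a g a = 0.
Proof. exact: subrr. Qed.

Lemma is_derive_primitive {R : realType} (a : R) (g : R -> R) (t : R) :
  continuous g -> a - 1 < t < a + 1 -> is_derive t 1 (primitive a g) (g t).
Proof.
move=> gc /andP[at1 ta1].
have gi : lebesgue_measure.-integrable `[a - 1, a + 1] (EFin \o g).
  apply: continuous_compact_integrable; first exact: segment_compact.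
  by apply: continuous_subspaceT => x; exact: gc.
have [dF F'] := continuous_FTC1_closed ta1 gi at1 (gc t).
set F := (fun x => _) in dF F'.
rewrite derive1E in F'; have h : is_derive t 1 F (g t) := DeriveDef dF F'.
by rewrite -[g t]subr0; exact: is_deriveB.
Qed.

(** The mean value theorem for a primitive, on an interval with closed ends. *)
Lemma derive_increment {R : realType} (P g : R -> R) (s t : R) :
  s <= t -> (forall r, s <= r <= t -> is_derive r 1 P (g r)) ->
  exists2 c, s <= c <= t & P t - P s = (t - s) * g c.
Proof.
move=> st Pd; have [r||c] := @MVT_segment R P g s t st.
- rewrite in_itv/= => /andP[sr rt]; apply: Pd.
  by rewrite (ltW sr) (ltW rt).
- apply: derivable_within_continuous => r; rewrite in_itv/= => /Pd h.
  exact: ex_derive.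
by rewrite in_itv/= mulrC; exists c.
Qed.

(** A sequence whose increments decay like powers of one half converges, with
    an explicit distance to the limit. *)
Lemma geometric_increments_cvg {R : realType} (u : nat -> R) (C : R) :
  (forall k, `|u k.+1 - u k| <= C / 2 ^+ k) ->
  exists l, forall k, `|l - u k| <= C *+ 2 / 2 ^+ k.
Proof.
move=> hu.
have C0 : 0 <= C.
  by have := le_trans (normr_ge0 _) (hu 0%N); rewrite expr0 divr1.
have tail k p : `|u (k + p)%N - u k| <= C *+ 2 / 2 ^+ k * (1 - 2^-1 ^+ p).
  elim: p => [|p IH]; first by rewrite addn0 subrr normr0 expr0 subrr mulr0.
  have -> : u (k + p.+1)%N - u k
      = (u (k + p).+1 - u (k + p)%N) + (u (k + p)%N - u k).
    by rewrite addnS addrA subrK.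
  apply: (le_trans (ler_normD _ _)); apply: (le_trans (lerD (hu _) IH)).
  rewrite exprD invfM exprS !exprVn.
  set a := (2 ^+ k)^-1; set c := (2 ^+ p)^-1; clearbody a c.
  have h2 : (2^-1 : R) * 2 = 1 by rewrite mulVf.
  by move: (2^-1 : R) h2 => h h2; nra.
have tail' k p : `|u (k + p)%N - u k| <= C *+ 2 / 2 ^+ k.
  apply: (le_trans (tail k p)); rewrite ler_piMr//.
  by rewrite divr_ge0 ?mulrn_wge0// exprn_ge0.
have ucvg : cvgn u.
  apply/cauchy_cvgP; apply: cauchy_exP => e e0.
  have hC : (C *+ 2) / 2 ^+ k @[k --> \oo] --> (C *+ 2 * 0 : R).
    under eq_fun do rewrite -exprVn.
    apply: cvgMr; apply: cvg_expr.
    by rewrite ger0_norm ?invr_ge0// invf_lt1// ltr1n.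
  rewrite mulr0 in hC.
  have /cvgr_dist_lt/(_ e e0) [K _ hK] := hC.
  exists (u K); exists K => // m /= Km.
  rewrite /ball/= distrC -(subnKC Km); apply: (le_lt_trans (tail' _ _)).
  have := hK K (leqnn K); rewrite /= sub0r normrN ger0_norm//.
  by rewrite divr_ge0 ?mulrn_wge0// exprn_ge0.
exists (limn u) => k.
have h : `|u p - u k| @[p --> \oo] --> `|limn u - u k|.
  by apply: cvg_norm; apply: cvgB => //; exact: cvg_cst.
rewrite -(cvg_lim (@Rhausdorff R) h); apply: limr_le.
  by apply/cvg_ex; eexists; exact: h.
by exists k => // p /= kp; rewrite -(subnKC kp).
Qed.

Lemma ler_add_geometric {R : realType} (x y D : R) :
  (forall k, x <= y + D / 2 ^+ k) -> x <= y.
Proof.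
move=> h.
have hD : y + D / 2 ^+ k @[k --> \oo] --> (y + D * 0 : R).
  apply: cvgD; first exact: cvg_cst.
  under eq_fun do rewrite -exprVn.
  apply: cvgMr; apply: cvg_expr.
  by rewrite ger0_norm ?invr_ge0// invf_lt1// ltr1n.
rewrite mulr0 addr0 in hD.
rewrite -(cvg_lim (@Rhausdorff R) hD); apply: limr_ge.
  by apply/cvg_ex; eexists; exact: hD.
by exists 0%N.
Qed.

(** The point of the segment [lo, hi] closest to [t]. *)
Definition clamp {R : realType} (lo hi t : R) : R := Num.max lo (Num.min hi t).

Lemma clamp_id {R : realType} (lo hi t : R) : lo <= t <= hi -> clamp lo hi t = t.
Proof. by move=> /andP[h1 h2]; rewrite /clamp (min_idPr h2) (max_idPr h1). Qed.

Lemma clamp_in_segment {R : realType} (lo hi t : R) :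
  lo <= hi -> lo <= clamp lo hi t <= hi.
Proof. by move=> h; rewrite /clamp le_max lexx/= ge_max ge_min lexx/= andbT. Qed.

Lemma clamp_dist {R : realType} (lo hi s t : R) :
  `|clamp lo hi s - clamp lo hi t| <= `|s - t|.
Proof.
have maxd (a x y : R) : `|Num.max a x - Num.max a y| <= `|x - y|.
  case: (leP a x) => h1; case: (leP a y) => h2; rewrite ?subrr ?normr0//;
  by rewrite ler_norml; case: (ger0P (x - y)) => h; apply/andP; split; lra.
have mind (a x y : R) : `|Num.min a x - Num.min a y| <= `|x - y|.
  case: (leP a x) => h1; case: (leP a y) => h2; rewrite ?subrr ?normr0//;
  by rewrite ler_norml; case: (ger0P (x - y)) => h; apply/andP; split; lra.
exact: le_trans (maxd _ _ _) (mind _ _ _).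
Qed.

(** Picard's iteration for an autonomous system that is globally Lipschitz and
    bounded. The system is given by its coordinates, with the sup distance on the
    states. The conclusion, a second order estimate with the field evaluated at
    any intermediate time, gives the one-sided and two-sided derivatives. *)
Lemma picard {R : realType} {I : Type} (G : I -> (I -> R) -> R) (L K a : R)
    (x0 : I -> R) :
  0 <= L -> 0 <= K ->
  (forall i x y e, (forall j, `|x j - y j| <= e) ->
     `|G i x - G i y| <= L * e) ->
  (forall i x, `|G i x| <= K) ->
  exists (e : R) (x : I -> R -> R), [/\ 0 < e, forall i, x i a = x0 i
    & forall i s r t, a <= s -> s <= r -> r <= t -> t <= a + e ->
      `|x i t - x i s - (t - s) * G i (x^~ r)| <= (t - s) * (L * (K * (t - s)))].
Proof.
move=> L0 K0 Glip Gbd.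
(* The time span makes each iteration a contraction by one half, and is shorter
   than 1 so that the primitives are differentiable on it. *)
pose e : R := (2 * (L + 1))^-1.
have L1 : 0 < L + 1 by lra.
have e0 : 0 < e by rewrite invr_gt0 mulr_gt0.
have eL : e * L <= 2^-1.
  rewrite /e invfM -mulrA ger_pMr ?invr_gt0// mulrC ler_pdivrMr//; lra.
have e1 : e < 1.
  by rewrite invf_lt1 ?mulr_gt0//; lra.
clearbody e; pose cl := clamp a (a + e).
have ae : a <= a + e by rewrite lerDl ltW.
have clampE t : a <= t <= a + e -> cl t = t by exact: clamp_id.
have clamp_in t : a <= cl t <= a + e by exact: clamp_in_segment.
(* Clamping the time makes the integrands continuous on the whole line. *)
pose g (Y : I -> R -> R) i t := G i (fun j => Y j (cl t)).
pose X := fix X k : I -> R -> R := if k is k'.+1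
  then fun i t => x0 i + primitive a (g (X k') i) t else fun i _ => x0 i.
pose lipY (Y : I -> R -> R) := forall i s t, a <= s -> s <= t -> t <= a + e ->
  `|Y i t - Y i s| <= K * (t - s).
have gcont Y i : lipY Y -> continuous (g Y i).
  move=> hY; apply: (@lipschitz_continuous _ _ (L * K)) => s t.
  rewrite -mulrA; apply: Glip => j.
  have h u v : cl v <= cl u ->
      `|Y j (cl u) - Y j (cl v)| <= K * `|u - v|.
    move=> uv; have /andP[? ?] := clamp_in u; have /andP[? ?] := clamp_in v.
    apply: (le_trans (hY _ _ _ _ uv _)) => //; apply: ler_wpM2l => //.
    exact: le_trans (ler_norm _) (clamp_dist _ _ _ _).
  case: (leP (cl t) (cl s)) => [/h//|/ltW/h].
  by rewrite distrC [X in _ <= _ * X -> _]distrC.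
have stepP Y i s t : lipY Y -> a <= s -> s <= t -> t <= a + e ->
    exists2 c, s <= c <= t & primitive a (g Y i) t - primitive a (g Y i) s
      = (t - s) * G i (Y^~ c).
  move=> hY as_ st ta.
  have [r|c cst ->] := @derive_increment _ (primitive a (g Y i)) (g Y i) _ _ st.
    by move=> /andP[? ?]; apply: is_derive_primitive; [exact: gcont|lra].
  exists c => //; rewrite /g clampE//; lra.
have Xlip k : lipY (X k).
  elim: k => [|k IH] i s t as_ st ta /=.
    by rewrite subrr normr0 mulr_ge0// subr_ge0.
  have [c _ h] := stepP _ i _ _ IH as_ st ta.
  rewrite opprD addrACA subrr add0r h normrM ger0_norm ?subr_ge0//.
  by rewrite mulrC; apply: ler_wpM2r; rewrite ?subr_ge0.
have Xstep k i t : a <= t -> t <= a + e ->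
    `|X k.+1 i t - X k i t| <= K * e / 2 ^+ k.
  elim: k i t => [|k IH] i t at_ ta.
    have [c _] := stepP _ i _ _ (Xlip 0%N) (lexx a) at_ ta.
    rewrite primitive_start subr0 /= => ->.
    rewrite addrAC subrr add0r divr1 normrM mulrC ler_pM//.
    by rewrite ger0_norm; lra.
  have [r|c cst] := @derive_increment _
      (primitive a (g (X k.+1) i) \- primitive a (g (X k) i))
      (g (X k.+1) i \- g (X k) i) _ _ at_.
    by move=> /andP[? ?]; apply: is_deriveB; apply: is_derive_primitive;
      solve [exact: gcont (Xlip _) | lra].
  move=> /=; rewrite !primitive_start !subr0 => dX.
  rewrite opprD addrACA subrr add0r dX.
  have cae : a <= c <= a + e by lra.
  have h : `|g (X k.+1) i c - g (X k) i c| <= L * (K * e / 2 ^+ k).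
    by apply: Glip => j; rewrite clampE//; apply: IH; lra.
  rewrite normrM ger0_norm ?subr_ge0//.
  apply: (@le_trans _ _ (e * (L * (K * e / 2 ^+ k)))).
    by apply: ler_pM => //; rewrite ?subr_ge0//; lra.
  rewrite mulrA exprS invfM [leRHS]mulrCA; apply: ler_wpM2r => //.
  by rewrite divr_ge0 ?exprn_ge0// mulr_ge0// ltW.
have /choice[x xP] (it : I * R) : exists l, a <= it.2 <= a + e ->
    forall k, `|l - X k it.1 it.2| <= (K * e) *+ 2 / 2 ^+ k.
  case: (pselect (a <= it.2 <= a + e)) => [/andP[h1 h2]|h]; last by exists 0.
  have [l hl] := @geometric_increments_cvg _ (fun k => X k it.1 it.2) (K * e)
    (fun k => Xstep k _ _ h1 h2).
  by exists l.
pose C := (K * e) *+ 2.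
have C0 : 0 <= C by rewrite mulrn_wge0// mulr_ge0// ltW.
exists e, (fun i t => x (i, t)); split=> // [i|i s r t as_ sr rt ta].
  have h k : X k i a = x0 i by case: k => //= k; rewrite primitive_start addr0.
  apply/eqP; rewrite -subr_eq0 -normr_le0; apply: (@ler_add_geometric _ _ _ C) => k.
  have := xP (i, a) _ k; rewrite /= h add0r; apply.
  by rewrite lexx lerDl ltW.
apply: (@ler_add_geometric _ _ _ (C *+ 2 + e * (L * C))) => k.
have st : s <= t by lra.
have [c cst h] := stepP _ i _ _ (Xlip k) as_ st ta.
have xt : `|x (i, t) - X k.+1 i t| <= C / 2 ^+ k.+1 by apply: xP => /=; lra.
have xs : `|x (i, s) - X k.+1 i s| <= C / 2 ^+ k.+1 by apply: xP => /=; lra.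
have hk : C / 2 ^+ k.+1 <= C / 2 ^+ k.
  have Cq : 0 <= C / 2 ^+ k by rewrite divr_ge0// exprn_ge0.
  by rewrite exprS invfM mulrCA; lra.
have hG : `|G i ((X k)^~ c) - G i (fun j => x (j, r))|
    <= L * (C / 2 ^+ k + K * (t - s)).
  apply: Glip => j; rewrite -(subrKA (X k j r)).
  apply: (le_trans (ler_normD _ _)); rewrite addrC; apply: lerD.
    rewrite distrC; apply: xP => /=; lra.
  have hb u v : s <= u -> u <= v -> v <= t ->
      `|X k j v - X k j u| <= K * (t - s).
    move=> su uv vt; apply: (le_trans (Xlip k j u v _ uv _)); try lra.
    by apply: ler_wpM2l => //; lra.
  case: (leP r c) => [rc|/ltW cr]; first by apply: hb; lra.
  by rewrite distrC; apply: hb; lra.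
have -> : x (i, t) - x (i, s) - (t - s) * G i (fun j => x (j, r))
  = (x (i, t) - X k.+1 i t) - (x (i, s) - X k.+1 i s)
    + (t - s) * (G i ((X k)^~ c) - G i (fun j => x (j, r))).
  by rewrite mulrBr -h /=; ring.
have ts0 : 0 <= t - s by lra.
apply: (le_trans (ler_normD _ _)); rewrite normrM (ger0_norm ts0).
have h3 := ler_wpM2l ts0 hG.
have h1 : `|(x (i, t) - X k.+1 i t) - (x (i, s) - X k.+1 i s)| <= C *+ 2 / 2 ^+ k.
  by apply: (le_trans (ler_normB _ _)); rewrite mulr2n mulrDl; lra.
have h2 : (t - s) * (L * (C / 2 ^+ k)) <= e * (L * (C / 2 ^+ k)).
  apply: ler_wpM2r; last by lra.
  by rewrite mulr_ge0// divr_ge0// exprn_ge0.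
by move: h1 h2 h3; rewrite !mulr2n; lra.
Qed.

(** * Coordinatewise calculus relative to a time interval *)

Lemma cvg_mxP {R : realType} {T : Type} {m n : nat} (F : set_system T)
    (FF : Filter F) (g : T -> 'M[R]_(m, n)) (v : 'M[R]_(m, n)) :
  (g s @[s --> F] --> v) <-> (forall i j, g s i j @[s --> F] --> v i j).
Proof.
split=> [gv i j|gv].
  exact: (cvg_comp _ _ gv (@coord_continuous R m n i j v)).
move=> A [P Pv PA]; apply: filterS PA _.
have : \forall s \near F, forall i j, P i j (g s i j).
  by apply: filter_forall => i; apply: filter_forall => j; exact: gv.
by [].
Qed.

(** The derivative at [t] of a real function relative to [A]; the analogue for
    coordinates of the derivative of a vector function. *)
Definition deriv_within {R : realType} (A : set R) (u : R -> R) (t v : R) : Prop :=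
  (s - t)^-1 * (u s - u t) @[s --> within A t^'] --> v.

Lemma has_derivative_withinP {R : realType} {d : nat} (A : set R)
    (x : R -> 'cV[R]_d) (t : R) (v : 'cV[R]_d) :
  has_derivative_within A x t v <->
  forall k, deriv_within A (fun s => x s k 0) t (v k 0).
Proof.
rewrite /has_derivative_within cvg_mxP; split=> h k.
  by have := h k 0; under eq_fun do rewrite !mxE.
by move=> j; rewrite ord1; under eq_fun do rewrite !mxE; exact: h.
Qed.

Section DerivWithin.
Context {R : realType}.
Implicit Types (A : set R).

Lemma deriv_within_cvg A (u : R -> R) (t v : R) :
  deriv_within A u t v -> u s @[s --> within A t^'] --> u t.
Proof.
move=> du; have h : u t + (s - t) * ((s - t)^-1 * (u s - u t))
    @[s --> within A t^'] --> u t + (t - t) * v.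
  apply: cvgD; first exact: cvg_cst.
  apply: cvgM => //; apply: cvgB; last exact: cvg_cst.
  by apply: cvg_within_filter; apply: cvg_within_filter; exact: cvg_id.
rewrite subrr mul0r addr0 in h; apply: cvg_trans h; apply: near_eq_cvg.
have : \forall s \near within A t^', s != t.
  by rewrite near_withinE; apply: filterS (nbhs_dnbhs_neq t) => s st _.
apply: filterS => s st.
by rewrite mulVKf ?subr_eq0// subrKC.
Qed.

Lemma deriv_within_cst A (c t : R) : deriv_within A (fun=> c) t 0.
Proof.
by rewrite /deriv_within; under eq_fun do rewrite subrr mulr0; exact: cvg_cst.
Qed.

Lemma deriv_withinD A (u w : R -> R) (t u' w' : R) :
  deriv_within A u t u' -> deriv_within A w t w' ->
  deriv_within A (fun s => u s + w s) t (u' + w').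
Proof.
rewrite /deriv_within => du dw.
by under eq_fun do rewrite opprD addrACA mulrDr; exact: cvgD.
Qed.

Lemma deriv_within_sum A (I : Type) (r : seq I) (u : I -> R -> R) (t : R) (u' : I -> R) :
  (forall i, deriv_within A (u i) t (u' i)) ->
  deriv_within A (fun s => \sum_(i <- r) u i s) t (\sum_(i <- r) u' i).
Proof.
move=> du; elim: r => [|i r IH].
  by rewrite big_nil; under eq_fun do rewrite big_nil; exact: deriv_within_cst.
by rewrite big_cons; under eq_fun do rewrite big_cons; exact: deriv_withinD.
Qed.

Lemma deriv_withinM A (u w : R -> R) (t u' w' : R) :
  deriv_within A u t u' -> deriv_within A w t w' ->
  deriv_within A (fun s => u s * w s) t (u' * w t + u t * w').
Proof.
move=> du dw.
have h : (s - t)^-1 * (u s - u t) * w s + u t * ((s - t)^-1 * (w s - w t))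
    @[s --> within A t^'] --> u' * w t + u t * w'.
  by apply: cvgD; apply: cvgM => //; [exact: deriv_within_cvg dw|exact: cvg_cst].
by apply: cvg_trans h; apply: near_eq_cvg; near=> s; ring.
Unshelve. all: by end_near. Qed.

Lemma deriv_withinV A (u : R -> R) (t u' : R) : u t != 0 -> deriv_within A u t u' ->
  deriv_within A (fun s => (u s)^-1) t (- (u' / u t ^+ 2)).
Proof.
move=> ut0 du; have uc := deriv_within_cvg _ _ _ _ du.
have h : - ((s - t)^-1 * (u s - u t) * ((u s)^-1 * (u t)^-1))
    @[s --> within A t^'] --> - (u' * ((u t)^-1 * (u t)^-1)).
  apply: cvgN; apply: cvgM => //; apply: cvgM; last exact: cvg_cst.
  exact: cvgV.
rewrite expr2 invfM; apply: cvg_trans h; apply: near_eq_cvg.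
have : \forall s \near within A t^', u s != 0 by exact: cvgr_neq0 uc _.
apply: filterS => s us0; move: (s - t)^-1 => c; field; exact/andP.
Qed.

Lemma deriv_within_sqrt A (u : R -> R) (t u' : R) : 0 < u t -> deriv_within A u t u' ->
  deriv_within A (fun s => Num.sqrt (u s)) t (u' / (2 * Num.sqrt (u t))).
Proof.
move=> ut0 du; have uc := deriv_within_cvg _ _ _ _ du.
have st0 : 0 < Num.sqrt (u t) by rewrite sqrtr_gt0.
have h : (s - t)^-1 * (u s - u t) / (Num.sqrt (u s) + Num.sqrt (u t))
    @[s --> within A t^'] --> u' / (Num.sqrt (u t) + Num.sqrt (u t)).
  apply: cvgM => //; apply: cvgV; first by rewrite gt_eqF// addr_gt0.
  apply: cvgD; last exact: cvg_cst.
  exact: (cvg_comp _ _ uc (@sqrt_continuous _ _)).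
rewrite mulr_natl mulr2n; apply: cvg_trans h; apply: near_eq_cvg.
have : \forall s \near within A t^', 0 < u s by exact: cvgr_gt uc _ ut0.
apply: filterS => s us0; rewrite -mulrA; congr (_ * _).
rewrite -[X in (X - _) / _]sqr_sqrtr ?ltW// -[X in (_ - X) / _]sqr_sqrtr ?ltW//.
by rewrite subr_sqr mulfK// gt_eqF// addr_gt0// sqrtr_gt0.
Qed.

(** At a point interior to [A] this is the ordinary derivative. *)
Lemma deriv_within_interior A (u : R -> R) (t v : R) :
  nbhs t A -> deriv_within A u t v <-> is_derive t (1 : R) u v.
Proof.
move=> At.
have key (P : R -> Prop) :
    (\forall s \near within A t^', P s) <-> (\forall h \near 0^', P (h + t)).
  have -> : (\forall s \near within A t^', P s)
    = (\forall s \near t, s != t -> A s -> P s) by [].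
  have -> : (\forall h \near 0^', P (h + t))
    = (\forall h \near (0 : R), h != 0 -> P (h + t)) by [].
  have h0 : (nbhs t A : Prop) := At.
  have hA : \forall s \near t, A s by exact: h0.
  rewrite (near_shift 0 t) in hA; rewrite (near_shift 0 t) subr0.
  rewrite subr0 in hA; split.
    apply: filterS2 hA => h /= Ah hP h0'; apply: hP => //.
    by rewrite -subr_eq0 addrK.
  apply: filterS => h /= hP; rewrite -subr_eq0 addrK => h0' _; exact: hP.
have keyc : deriv_within A u t v <->
    h^-1 *: (u (h *: 1 + t) - u t) @[h --> 0^'] --> v.
  rewrite /deriv_within; split=> /cvgrPdist_lt H; apply/cvgrPdist_lt => e e0.
    have /key := H e e0; apply: filterS => h.
    by rewrite addrK /GRing.scale/= mulr1.
  apply/key; have := H e e0; apply: filterS => h.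
  by rewrite addrK /GRing.scale/= mulr1.
split=> [/keyc h|[du dv]]; last by apply/keyc; rewrite -dv; exact: du.
by apply: DeriveDef; [apply/cvg_ex; exists v|apply/cvg_lim].
Qed.

End DerivWithin.

(** * First-passage comparison *)

Section TimeInterval.
Context {R : realType}.
Implicit Types (b : \bar R) (t : R).

Lemma time_interval_le b s t :
  0 <= s -> s <= t -> time_interval b t -> time_interval b s.
Proof.
by move=> s0 st [_ tb]; split=> //; apply: le_lt_trans tb; rewrite lee_fin.
Qed.

Lemma time_interval_nbhs b t :
  0 < t -> time_interval b t -> nbhs t (time_interval b).
Proof.
move=> t0 [_ tb].
have lt_b : \forall s \near t, (s%:E < b)%E.
  case: b tb => [b||] tb //=.
    by apply: (@lt_nbhsl R); rewrite -lte_fin.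
  by apply: (filterE (F := nbhs t)) => s; rewrite ltry.
have : \forall s \near t, 0 < s by exact: lt_nbhsr.
by apply: filterS2 lt_b => s sb s0; split=> //; exact: ltW.
Qed.

End TimeInterval.

(** If each of finitely many continuous functions starts above the level [c],
    and if none of them can be the first to come down to [c] (at the first
    passage time it would have to come from below), then all stay above [c]. *)
Lemma first_passage {R : realType} (m : nat) (q : 'I_m -> R -> R) (b : \bar R)
    (c : R) :
  (forall i, {within time_interval b, continuous (q i)}) ->
  (forall i, c < q i 0) ->
  (forall i t, 0 < t -> time_interval b t -> (forall j, c <= q j t) ->
     q i t = c -> exists2 s, 0 <= s < t & q i s < c) ->
  forall i t, time_interval b t -> c < q i t.
Proof.
move=> qc q0 hit i0 t0 t0b; rewrite ltNge; apply/negP => q0t0.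
pose S := [set t | 0 <= t <= t0 /\ exists i, q i t <= c].
have t00 : 0 <= t0 by case: t0b.
have S0 : S t0 by split; [rewrite t00 lexx|exists i0].
have Slb : lbound S 0 by move=> t [/andP[]].
have Sinf : has_inf S by split; [exists t0|exists 0].
pose T := inf S.
have T0 : 0 <= T by apply: lb_le_inf => //; exists t0.
have Tt0 : T <= t0 by apply: ge_inf => //; exists 0.
have Tb : time_interval b T by exact: time_interval_le t0b.
have before s i : 0 <= s -> s < T -> c < q i s.
  move=> s0 sT; rewrite ltNge; apply/negP => qs.
  suff : T <= s by rewrite leNgt sT.
  apply: ge_inf; first by exists 0.
  by split; [rewrite s0 (le_trans (ltW sT))|exists i].
have qcT i : q i s @[s --> within (time_interval b) (nbhs T)] --> q i T.
  by have /subspace_continuousP := qc i; exact.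
have [i qiT] : exists i, q i T <= c.
  apply: contrapT => /forallNP nq.
  have : \forall s \near within (time_interval b) (nbhs T), forall i, c < q i s.
    apply: filter_forall => i; apply: (cvgr_gt _ (qcT i)).
    by rewrite ltNge; apply/negP; exact: nq.
  move=> /nbhs_ballP[e /= e0 he].
  have [s [/andP[s0 st] [i qs]] sT] := inf_adherent e0 Sinf.
  have sb : time_interval b s by exact: time_interval_le t0b.
  have Ts : T <= s by apply: ge_inf; [exists 0|split; [rewrite s0|exists i]].
  have bs : ball T e s by rewrite /ball/= ltr_norml; apply/andP; split; lra.
  by have := he s bs sb i; rewrite ltNge qs.
have T_gt0 : 0 < T.
  rewrite lt_neqAle T0 andbT; apply/eqP => TE.
  by move: qiT; rewrite -TE leNgt q0.
have above j : c <= q j T.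
  rewrite leNgt; apply/negP => qjT.
  have : \forall s \near within (time_interval b) (nbhs T), q j s < c.
    exact: cvgr_lt _ (qcT j) _ qjT.
  move=> /nbhs_ballP[e /= e0 he].
  pose s := Num.max 0 (T - e / 2).
  have s0 : 0 <= s by rewrite le_max lexx.
  have sT : s < T by rewrite gt_max T_gt0/=; lra.
  have : T - e < s by rewrite lt_max; apply/orP; right; lra.
  move=> sTe.
  have bs : ball T e s by rewrite /ball/= ltr_norml; apply/andP; split; lra.
  have := he s bs (time_interval_le _ _ _ s0 (ltW sT) Tb).
  by move=> /(lt_trans (before s j s0 sT)); rewrite ltxx.
have qiTE : q i T = c by apply/eqP; rewrite eq_le qiT above.
have [s /andP[s0 sT] qs] := hit i T T_gt0 Tb above qiTE.
by have := before s i s0 sT; rewrite ltNge ltW.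
Qed.

(** A function whose derivative is positive just before [t] takes smaller values
    before [t]; no derivative is needed at [t] itself. *)
Lemma smaller_before {R : realType} (q dq : R -> R) (t : R) :
  0 < t -> {within `[0, t], continuous q} ->
  (\forall s \near t^'-, is_derive s (1 : R) q (dq s) /\ 0 < dq s) ->
  exists2 s, 0 <= s < t & q s < q t.
Proof.
move=> t0 qc; rewrite /at_left near_withinE => /nbhs_ballP[e /= e0 he].
pose s := Num.max 0 (t - e / 2).
have s0 : 0 <= s by rewrite le_max lexx.
have st : s < t by rewrite gt_max t0/=; lra.
have sTe : t - e < s by rewrite lt_max; apply/orP; right; lra.
have h r : s < r -> r < t -> is_derive r (1 : R) q (dq r) /\ 0 < dq r.
  move=> sr rt; apply: he => //.
  by rewrite /ball/= ltr_norml; apply/andP; split; lra.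
exists s; first by rewrite s0.
have [r||c] := @MVT _ q dq s t st.
- by rewrite in_itv/= => /andP[sr rt]; have [] := h _ sr rt.
- apply: continuous_subspaceW qc => r/=; rewrite !in_itv/= => /andP[sr ->].
  by rewrite (le_trans s0 sr).
rewrite in_itv/= => /andP[sr rt] E.
by rewrite -subr_gt0 E mulr_gt0// ?subr_gt0//; have [] := h _ sr rt.
Qed.

(** Switching times do not accumulate. *)
Lemma switching_time_isolated {R : realType} {n : nat} (N : 'I_n -> R -> {set 'I_n})
    (t : R) :
  time_varying_neighborhoods N -> \forall s \near t^', ~ switching_time N s.
Proof.
move=> [pc _].
have : \forall s \near t^', forall i, ~ Defs.discontinuity (N i) s.
  apply: filter_forall => i; have [fin _] := pc i.
  pose D := (Defs.discontinuity (N i) `&` `[t - 1, t + 1]) `\ t.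
  have Dfin : finite_set D by apply: finite_setD; exact: fin.
  have Dc : closed D by apply: (accessible_finite_set_closed.1 _ _ Dfin);
    apply: hausdorff_accessible; exact: Rhausdorff.
  have : \forall s \near t, (~` D) s.
    apply: open_nbhs_nbhs; split; first exact: closed_openC.
    by move=> [_ /(_ erefl)].
  rewrite /dnbhs near_withinE => tD.
  have tl : \forall s \near t, t - 1 < s by apply: lt_nbhsr; lra.
  have tr : \forall s \near t, s < t + 1 by apply: lt_nbhsl; lra.
  near=> s => st ds; have : (~` D) s by near: s.
  apply; split; last by move/eqP: st.
  split=> //=; rewrite in_itv/=; apply/andP; split; apply: ltW; near: s => //.
by apply: filterS => s ns [i]; exact: ns.
Unshelve. all: by end_near. Qed.

(** * Euclidean geometry of column vectors *)

Section Euclid.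
Context {R : realType} {d : nat}.
Implicit Types (u v w : 'cV[R]_d).

(** The Euclidean inner product. *)
Definition dotv u v : R := \sum_k u k 0 * v k 0.

Lemma dotvC u v : dotv u v = dotv v u.
Proof. by apply: eq_bigr => k _; rewrite mulrC. Qed.

Lemma dotvDl u v w : dotv (u + v) w = dotv u w + dotv v w.
Proof. by rewrite -big_split; apply: eq_bigr => k _; rewrite mxE mulrDl. Qed.

Lemma dotvZl (a : R) u v : dotv (a *: u) v = a * dotv u v.
Proof. by rewrite mulr_sumr; apply: eq_bigr => k _; rewrite mxE mulrA. Qed.

Lemma dotvNl u v : dotv (- u) v = - dotv u v.
Proof. by rewrite -scaleN1r dotvZl mulN1r. Qed.

Lemma dotvDr u v w : dotv w (u + v) = dotv w u + dotv w v.
Proof. by rewrite !(dotvC w) dotvDl. Qed.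

Lemma dotvZr (a : R) u v : dotv v (a *: u) = a * dotv v u.
Proof. by rewrite !(dotvC v) dotvZl. Qed.

Lemma dotvNr u v : dotv v (- u) = - dotv v u.
Proof. by rewrite !(dotvC v) dotvNl. Qed.

Lemma dotv0l v : dotv 0 v = 0.
Proof. by rewrite -(scale0r 0) dotvZl mul0r. Qed.

Lemma dotv_sumr (I : Type) (r : seq I) (P : pred I) (F : I -> 'cV[R]_d) v :
  dotv v (\sum_(i <- r | P i) F i) = \sum_(i <- r | P i) dotv v (F i).
Proof.
apply: (big_morph (dotv v)) => [x y|]; first exact: dotvDr.
by rewrite dotvC dotv0l.
Qed.

Lemma mulmx_tr_dotv u v w : (u *m v^T) *m w = dotv v w *: u.
Proof.
apply/matrixP => i j; rewrite !mxE ord1 /dotv mulr_suml.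
by apply: eq_bigr => k _; rewrite !mxE big_ord1 !mxE; ring.
Qed.

Lemma euclid_norm_ge0 u : 0 <= euclid_norm u.
Proof. exact: sqrtr_ge0. Qed.

Lemma dotvv_ge0 u : 0 <= dotv u u.
Proof. by apply: sumr_ge0 => k _; rewrite -expr2 sqr_ge0. Qed.

Lemma euclid_normE u : euclid_norm u = Num.sqrt (dotv u u).
Proof. by congr Num.sqrt; apply: eq_bigr => k _; rewrite expr2. Qed.

Lemma sqr_euclid_norm u : euclid_norm u ^+ 2 = dotv u u.
Proof. by rewrite euclid_normE sqr_sqrtr// dotvv_ge0. Qed.

Lemma dotvv_eq0 u : (dotv u u == 0) = (u == 0).
Proof.
apply/idP/eqP => [|->]; last by rewrite dotv0l.
rewrite psumr_eq0 => [/allP h|k _]; last by rewrite -expr2 sqr_ge0.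
apply/matrixP => k j; rewrite ord1 mxE.
by have := h k (mem_index_enum k); rewrite /= mulf_eq0 orbb => /eqP.
Qed.

Lemma dotvv_gt0 u : (0 < dotv u u) = (u != 0).
Proof. by rewrite lt_neqAle dotvv_ge0 andbT eq_sym dotvv_eq0. Qed.

Lemma euclid_norm_gt0 u : (0 < euclid_norm u) = (u != 0).
Proof. by rewrite euclid_normE sqrtr_gt0 dotvv_gt0. Qed.

Lemma euclid_normZ (a : R) u : euclid_norm (a *: u) = `|a| * euclid_norm u.
Proof.
by rewrite !euclid_normE dotvZl dotvZr mulrA -expr2 sqrtrM ?sqr_ge0// sqrtr_sqr.
Qed.

Lemma euclid_normN u : euclid_norm (- u) = euclid_norm u.
Proof. by rewrite -scaleN1r euclid_normZ normrN1 mul1r. Qed.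

Lemma dotv_cauchy_schwarz u v : `|dotv u v| <= euclid_norm u * euclid_norm v.
Proof.
rewrite -[leRHS]ger0_norm ?mulr_ge0 ?euclid_norm_ge0//.
rewrite -ler_sqr ?nnegrE// !real_normK ?num_real// exprMn !sqr_euclid_norm.
have [->|v0] := eqVneq v 0; first by rewrite !(dotvC _ 0) !dotv0l expr0n/= mulr0.
have B0 : 0 < dotv v v by rewrite dotvv_gt0.
have := dotvv_ge0 (dotv v v *: u - dotv u v *: v).
rewrite !(dotvDl, dotvDr, dotvNl, dotvNr, dotvZl, dotvZr) (dotvC v u).
set A := dotv u u; set B := dotv v v; set D := dotv u v => h.
have : 0 <= B * (A * B - D ^+ 2).
  by rewrite (le_trans h)// le_eqVlt; apply/orP; left; apply/eqP; ring.
by rewrite pmulr_rge0// subr_ge0.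
Qed.

Lemma euclid_normD u v : euclid_norm (u + v) <= euclid_norm u + euclid_norm v.
Proof.
rewrite -ler_sqr ?nnegrE ?addr_ge0 ?euclid_norm_ge0//.
rewrite sqrrD !sqr_euclid_norm !(dotvDl, dotvDr) (dotvC v u).
have := le_trans (ler_norm _) (dotv_cauchy_schwarz u v); lra.
Qed.

Lemma euclid_norm_dist u v :
  `|euclid_norm u - euclid_norm v| <= euclid_norm (u - v).
Proof.
have h1 := euclid_normD (u - v) v; have h2 := euclid_normD (v - u) u.
rewrite !subrK in h1 h2; rewrite -(opprB u v) euclid_normN in h2.
by rewrite ler_norml; apply/andP; split; lra.
Qed.

Lemma euclid_norm_le_sum u : euclid_norm u <= \sum_k `|u k 0|.
Proof.
have s0 (P : pred 'I_d) : 0 <= \sum_(k | P k) `|u k 0| by exact: sumr_ge0.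
rewrite -ler_sqr ?nnegrE ?euclid_norm_ge0// sqr_euclid_norm expr2 mulr_suml.
apply: ler_sum => k _; apply: (le_trans (ler_norm _)); rewrite normrM.
by apply: ler_wpM2l => //; rewrite (bigD1 k)//= lerDl.
Qed.

Lemma coord_le_euclid_norm u k : `|u k 0| <= euclid_norm u.
Proof.
rewrite -ler_sqr ?nnegrE ?euclid_norm_ge0// real_normK ?num_real//.
rewrite sqr_euclid_norm expr2 /dotv (bigD1 k)//= lerDl.
by apply: sumr_ge0 => j _; rewrite -expr2 sqr_ge0.
Qed.

Lemma euclid_norm_unit_vec u : u != 0 -> euclid_norm (unit_vec u) = 1.
Proof.
move=> u0; have := u0; rewrite -euclid_norm_gt0 => r0.
by rewrite /unit_vec euclid_normZ ger0_norm ?invr_ge0 ?ltW// mulVf// gt_eqF.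
Qed.

Lemma unit_vec_dist u v : u != 0 -> v != 0 ->
  0 <= euclid_norm (unit_vec u - unit_vec v) <= 2.
Proof.
move=> u0 v0; rewrite euclid_norm_ge0/=.
apply: (le_trans (euclid_normD _ _)).
by rewrite euclid_normN !euclid_norm_unit_vec//; lra.
Qed.

End Euclid.

(** * Bounds on the weights and on the lifted field *)

Lemma weights_lipschitz {R : realType} {n : nat} (f : 'I_n -> 'I_n -> R -> R) :
  weights f -> exists2 L, 0 <= L &
    forall i j r s, `|f i j r - f i j s| <= L * `|r - s|.
Proof.
move=> fw.
have : \forall L \near +oo, forall i j,
    forall r, setT r -> `|self_sub (f i j) r| <= L * `|self_sub id r|.
  apply: filter_forall => i; apply: filter_forall => j.
  have [+ _] := fw i j; rewrite /lipschitz_on; apply: filterS => L hL r _.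
  by apply: hL.
move=> hL; have [L L0 h] := pinfty_ex_gt0 hL.
by exists L; [exact: ltW|move=> i j r s; exact: (h i j (r, s) I)].
Qed.

(** The weights are nonnegative, and bounded, on the possible distances between
    two points of the unit sphere. At distance zero the sign follows by
    continuity. *)
Lemma weights_bounded {R : realType} {n : nat} (f : 'I_n -> 'I_n -> R -> R) :
  weights f -> exists2 M, 0 <= M &
    forall i j r, 0 <= r <= 2 -> 0 <= f i j r <= M.
Proof.
move=> fw; have [L L0 fL] := weights_lipschitz _ fw.
have f0 i j r : 0 <= r -> 0 <= f i j r.
  have [_ fpos] := fw i j.
  rewrite le_eqVlt => /predU1P[<-|/fpos/ltW//].
  apply/ler_addgt0Pr => e e0; pose s := e / (L + 1).
  have s0 : 0 < s by rewrite divr_gt0//; lra.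
  have sE : s * (L + 1) = e by rewrite divfK// gt_eqF//; lra.
  have := fL i j s 0; rewrite subr0 (ger0_norm (ltW s0)) ler_norml.
  by have := fpos _ s0; nra.
exists (\sum_i \sum_j f i j 0 + 2 * L) => [|i j r /andP[r0 r2]].
  by rewrite addr_ge0// ?mulr_ge0//; do 2 (apply: sumr_ge0 => ? _); exact: f0.
rewrite f0//=.
have h1 : f i j 0 <= \sum_i \sum_j f i j 0.
  rewrite (bigD1 i)//= (bigD1 j)//= -addrA lerDl addr_ge0//.
    by apply: sumr_ge0 => ? _; exact: f0.
  by do 2 (apply: sumr_ge0 => ? _); exact: f0.
have := fL i j r 0; rewrite subr0 (ger0_norm r0) ler_norml.
by nra.
Qed.

Lemma sum_const_le {R : realType} {n : nat} (c : R) (T : {set 'I_n})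
    (g : 'I_n -> R) :
  0 <= c -> (forall j, g j <= c) -> \sum_(j in T) g j <= n%:R * c.
Proof.
move=> c0 gc; rewrite big_mkcond; apply: (@le_trans _ _ (\sum_(j < n) c)).
  by apply: ler_sum => j _; case: ifP.
by rewrite sumr_const card_ord mulr_natl.
Qed.

Section FieldBounds.
Context {R : realType} {n d : nat}.
Variables (f : 'I_n -> 'I_n -> R -> R) (M : R).
Hypothesis fM : forall i j r, 0 <= r <= 2 -> 0 <= f i j r <= M.
Variables (N : 'I_n -> {set 'I_n}) (z : 'I_n -> 'cV[R]_d) (i : 'I_n).
Hypothesis z0 : forall j, z j != 0.
Let r j := euclid_norm (z j).
Let F j := f i j (euclid_norm (unit_vec (z j) - unit_vec (z i))).

Let r0 j : 0 < r j. Proof. by rewrite euclid_norm_gt0. Qed.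

Let F0M j : 0 <= F j <= M. Proof. by apply: fM; exact: unit_vec_dist. Qed.

Lemma dotv_lifted_field : dotv (z i) (lifted_field f N z i)
  = \sum_(j in N i) F j * (r i / r j) * (dotv (z i) (z j) - r i ^+ 2).
Proof.
rewrite dotv_sumr; apply: eq_bigr => j _.
by rewrite dotvZr dotvDr dotvNr /r sqr_euclid_norm.
Qed.

Let dotle j : `|dotv (z i) (z j)| <= r i * r j.
Proof. exact: dotv_cauchy_schwarz. Qed.

(** The outward speed of a node is at most proportional to its norm. *)
Lemma lifted_field_upper :
  dotv (z i) (lifted_field f N z i) <= n%:R * (M * dotv (z i) (z i)).
Proof.
rewrite dotv_lifted_field -sqr_euclid_norm -/(r i).
have M0 : 0 <= M by have /andP[/le_trans] := F0M i; apply.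
apply: sum_const_le => [|j]; first by rewrite mulr_ge0 ?sqr_ge0.
have /andP[F0 FM] := F0M j; have := dotle j; rewrite ler_norml => /andP[_ D].
have rj := r0 j; have ri := r0 i.
apply: (@le_trans _ _ (F j * (r i / r j) * (r i * r j))).
  apply: ler_wpM2l; first by rewrite mulr_ge0// divr_ge0// ltW.
  by rewrite lerBlDr; have := sqr_ge0 (r i); lra.
have -> : F j * (r i / r j) * (r i * r j) = F j * r i ^+ 2.
  by field; rewrite gt_eqF.
by apply: ler_wpM2r => //; rewrite sqr_ge0.
Qed.

(** The inward speed of a node is at most proportional to its norm, as long as
    its norm is not much larger than those of the other nodes. *)
Lemma lifted_field_lower : (forall j, r i <= 2 * r j) ->
  - (n%:R * (3 * M * dotv (z i) (z i))) <= dotv (z i) (lifted_field f N z i).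
Proof.
move=> r2; rewrite dotv_lifted_field -sqr_euclid_norm -/(r i) lerNl -sumrN.
have M0 : 0 <= M by have /andP[/le_trans] := F0M i; apply.
apply: sum_const_le => [|j]; first by rewrite mulr_ge0 ?sqr_ge0// mulr_ge0.
have /andP[F0 FM] := F0M j; have := dotle j; rewrite ler_norml => /andP[D _].
have rj := r0 j; have ri := r0 i.
rewrite -mulrN; apply: (@le_trans _ _ (F j * (r i / r j) * (r i * r j + r i ^+ 2))).
  apply: ler_wpM2l; first by rewrite mulr_ge0// divr_ge0// ltW.
  by rewrite opprB; lra.
have -> : F j * (r i / r j) * (r i * r j + r i ^+ 2)
    = F j * ((1 + r i / r j) * r i ^+ 2).
  by field; rewrite gt_eqF.
rewrite (mulrC 3) -mulrA; apply: ler_pM => //.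
  by rewrite mulr_ge0 ?sqr_ge0// addr_ge0// divr_ge0// ltW.
apply: ler_wpM2r; rewrite ?sqr_ge0//.
have : r i / r j <= 2 by rewrite ler_pdivrMr.
by lra.
Qed.

Lemma lifted_field_coord (m B : R) (k : 'I_d) : 0 < m ->
  (forall j, m <= r j <= B) ->
  `|lifted_field f N z i k 0| <= n%:R * (M * (B / m) * (2 * B)).
Proof.
move=> m0 rmB.
have M0 : 0 <= M by have /andP[/le_trans] := F0M i; apply.
have B0 : 0 <= B by have /andP[h1 h2] := rmB i; lra.
rewrite /lifted_field summxE; apply: (le_trans (ler_norm_sum _ _ _)).
apply: sum_const_le => [|j]; first by rewrite !mulr_ge0 ?invr_ge0// ltW.
have /andP[F0 FM] := F0M j; have /andP[mj jB] := rmB j; have /andP[mi iB] := rmB i.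
rewrite mxE normrM; apply: ler_pM => //.
  rewrite ger0_norm; last by rewrite mulr_ge0// divr_ge0// euclid_norm_ge0.
  apply: ler_pM => //; first by rewrite divr_ge0// euclid_norm_ge0.
  apply: ler_pM; rewrite ?invr_ge0 ?euclid_norm_ge0//.
  by rewrite lef_pV2 ?posrE// euclid_norm_gt0.
apply: (le_trans (coord_le_euclid_norm _ _)); apply: (le_trans (euclid_normD _ _)).
by rewrite euclid_normN; move: jB iB; rewrite /r; lra.
Qed.

End FieldBounds.

(** * Local Lipschitz continuity of the lifted field *)

(** A function [h] of real coordinates indexed by [J] is Lipschitz, for the sup
    distance, on a neighborhood of [p]. A single constant bounds the Lipschitz
    constant and the inverse of the radius, so that it may be enlarged freely. *)
Definition loc_lipschitz {R : realType} {J : Type} (p : J -> R)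
    (h : (J -> R) -> R) : Prop :=
  exists2 M : R, 0 < M & forall x y e, 0 <= e ->
    (forall j, `|x j - p j| <= M^-1) -> (forall j, `|y j - p j| <= M^-1) ->
    (forall j, `|x j - y j| <= e) -> `|h x - h y| <= M * e.

Section LocLipschitz.
Context {R : realType} {J : Type}.
Variable p : J -> R.
Implicit Types h g : (J -> R) -> R.

(** A function whose increments are dominated by those of finitely many locally
    Lipschitz functions. *)
Lemma loc_lipschitz_dominated (I : finType) (g : I -> (J -> R) -> R) h (L : R) :
  0 <= L -> (forall i, loc_lipschitz p (g i)) ->
  (forall x y, `|h x - h y| <= L * \sum_i `|g i x - g i y|) ->
  loc_lipschitz p h.
Proof.
move=> L0 gl hg.
have [m m0 mP] : exists2 m : I -> R, (forall i, 0 < m i) &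
    forall i x y e, 0 <= e ->
    (forall j, `|x j - p j| <= (m i)^-1) -> (forall j, `|y j - p j| <= (m i)^-1) ->
    (forall j, `|x j - y j| <= e) -> `|g i x - g i y| <= m i * e.
  have /choice[m mP] i : exists m, 0 < m /\ forall x y e, 0 <= e ->
      (forall j, `|x j - p j| <= m^-1) -> (forall j, `|y j - p j| <= m^-1) ->
      (forall j, `|x j - y j| <= e) -> `|g i x - g i y| <= m * e.
    by have [m m0 h'] := gl i; exists m.
  by exists m => i; [have [] := mP i|have [_] := mP i].
have S0 : 0 <= \sum_i m i by apply: sumr_ge0 => i _; exact: ltW.
have LS : 0 <= L * \sum_i m i by rewrite mulr_ge0.
have M0 : 0 < 1 + (\sum_i m i) + L * \sum_i m i by lra.
exists (1 + (\sum_i m i) + L * \sum_i m i) => // x y e e0 hx hy hxy.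
have mle i : (1 + (\sum_i m i) + L * \sum_i m i)^-1 <= (m i)^-1.
  rewrite lef_pV2 ?posrE//.
  have : m i <= \sum_i m i.
    by rewrite (bigD1 i)//= lerDl; apply: sumr_ge0 => j _; exact: ltW.
  lra.
apply: (le_trans (hg _ _)); apply: (@le_trans _ _ (L * (\sum_i m i) * e)).
  rewrite -mulrA; apply: ler_wpM2l => //; rewrite mulr_suml.
  apply: ler_sum => i _; apply: mP => // j; exact: le_trans (mle i).
by apply: ler_wpM2r => //; lra.
Qed.

Lemma loc_lipschitz_coord j : loc_lipschitz p (fun x => x j).
Proof. by exists 1 => // x y e _ _ _ h; rewrite mul1r. Qed.

Lemma loc_lipschitz_comp (phi : R -> R) h (L : R) : 0 <= L ->
  (forall s t, `|phi s - phi t| <= L * `|s - t|) ->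
  loc_lipschitz p h -> loc_lipschitz p (fun x => phi (h x)).
Proof.
move=> L0 philip hl.
apply: (loc_lipschitz_dominated unit (fun=> h) _ L) => // x y.
by rewrite (big_pred1 tt) => [|[]//]; exact: philip.
Qed.

Lemma loc_lipschitzB h g : loc_lipschitz p h -> loc_lipschitz p g ->
  loc_lipschitz p (fun x => h x - g x).
Proof.
move=> hl gl.
apply: (loc_lipschitz_dominated bool (fun b => if b then h else g) _ 1)
  => [//|[]//|x y].
rewrite big_bool/= mul1r.
have -> : h x - g x - (h y - g y) = (h x - h y) - (g x - g y) by ring.
exact: ler_normB.
Qed.

Lemma loc_lipschitz_sum (I : finType) (P : pred I) (g : I -> (J -> R) -> R) :
  (forall i, loc_lipschitz p (g i)) ->
  loc_lipschitz p (fun x => \sum_(i | P i) g i x).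
Proof.
move=> gl; apply: (loc_lipschitz_dominated I g _ 1) => // x y.
rewrite mul1r -sumrB; apply: (le_trans (ler_norm_sum _ _ _)).
by rewrite big_mkcond; apply: ler_sum => i _; case: ifP.
Qed.

Lemma loc_lipschitz_euclid_norm d (g : 'I_d -> (J -> R) -> R) :
  (forall k, loc_lipschitz p (g k)) ->
  loc_lipschitz p (fun x => euclid_norm (\col_k g k x)).
Proof.
move=> gl; apply: (loc_lipschitz_dominated _ g _ 1) => // x y; rewrite mul1r.
apply: (le_trans (euclid_norm_dist _ _)); apply: (le_trans (euclid_norm_le_sum _)).
by apply: ler_sum => k _; rewrite !mxE.
Qed.

Lemma loc_lipschitzM h g : loc_lipschitz p h -> loc_lipschitz p g ->
  loc_lipschitz p (fun x => h x * g x).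
Proof.
move=> [M M0 hM] [K K0 gK].
pose C := (`|h p| + 1) * K + (`|g p| + 1) * M.
have C0 : 0 <= C.
  by rewrite addr_ge0// mulr_ge0// ?addr_ge0// ltW.
have D0 : 0 < M + K + C by lra.
have pp (q : R) : 0 < q -> forall j, `|p j - p j| <= q^-1.
  by move=> q0 j; rewrite subrr normr0 invr_ge0 ltW.
have bound (u : (J -> R) -> R) (q : R) x : 0 < q ->
    (forall x y e, 0 <= e ->
    (forall j, `|x j - p j| <= q^-1) -> (forall j, `|y j - p j| <= q^-1) ->
    (forall j, `|x j - y j| <= e) -> `|u x - u y| <= q * e) ->
    (forall j, `|x j - p j| <= q^-1) -> `|u x| <= `|u p| + 1.
  move=> q0 hu hx; have qi : 0 <= q^-1 by rewrite invr_ge0 ltW.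
  have := hu x p q^-1 qi hx (pp q q0) hx; rewrite mulfV ?gt_eqF// => hup.
  by have := ler_normD (u x - u p) (u p); rewrite subrK; lra.
exists (M + K + C) => // x y e e0 hx hy hxy.
have leM : (M + K + C)^-1 <= M^-1 by rewrite lef_pV2 ?posrE//; lra.
have leK : (M + K + C)^-1 <= K^-1 by rewrite lef_pV2 ?posrE//; lra.
have hxM j := le_trans (hx j) leM; have hxK j := le_trans (hx j) leK.
have hyM j := le_trans (hy j) leM; have hyK j := le_trans (hy j) leK.
have -> : h x * g x - h y * g y = h x * (g x - g y) + (h x - h y) * g y by ring.
apply: (le_trans (ler_normD _ _)); rewrite !normrM.
apply: (@le_trans _ _ ((`|h p| + 1) * (K * e) + (M * e) * (`|g p| + 1))).
  apply: lerD; apply: ler_pM => //.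
  - exact: bound hM hxM.
  - exact: gK.
  - exact: hM.
  - exact: bound gK hyK.
have : 0 <= M * e by rewrite mulr_ge0// ltW.
have : 0 <= K * e by rewrite mulr_ge0// ltW.
rewrite /C; lra.
Qed.

Lemma loc_lipschitzV h : h p != 0 -> loc_lipschitz p h ->
  loc_lipschitz p (fun x => (h x)^-1).
Proof.
move=> hp0 [M M0 hM]; pose c := `|h p|.
have c0 : 0 < c by rewrite normr_gt0.
have D1 : 0 <= 2 * M / c by rewrite divr_ge0 ?mulr_ge0// ltW.
have D2 : 0 <= 4 * M / c ^+ 2 by rewrite divr_ge0 ?mulr_ge0 ?sqr_ge0// ltW.
have D0 : 0 < M + 2 * M / c + 4 * M / c ^+ 2 by lra.
exists (M + 2 * M / c + 4 * M / c ^+ 2) => // x y e e0.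
set D := M + _ + _ in D0 * => hx hy hxy.
have leM : D^-1 <= M^-1 by rewrite lef_pV2 ?posrE// /D; lra.
have leD : M * D^-1 <= c / 2.
  rewrite ler_pdivrMr//; have -> : M = c / 2 * (2 * M / c) by field; rewrite gt_eqF.
  by apply: ler_wpM2l; [rewrite divr_ge0// ltW|rewrite /D; lra].
have Di : 0 <= D^-1 by rewrite invr_ge0 ltW.
have far w : (forall j, `|w j - p j| <= D^-1) -> c / 2 <= `|h w|.
  move=> hw.
  have hpp j : `|p j - p j| <= M^-1 by rewrite subrr normr0 invr_ge0 ltW.
  have := hM w p D^-1 Di (fun j => le_trans (hw j) leM) hpp hw.
  have := lerB_dist (h p) (h w); rewrite distrC -/c; lra.
have hx0 : 0 < `|h x| by have := far x hx; lra.
have hy0 : 0 < `|h y| by have := far y hy; lra.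
have -> : (h x)^-1 - (h y)^-1 = (h y - h x) / (h x * h y).
  by field; rewrite -!normr_gt0 hx0 hy0.
rewrite normrM normfV normrM distrC ler_pdivrMr ?mulr_gt0//.
have hxM j := le_trans (hx j) leM; have hyM j := le_trans (hy j) leM.
have hd := hM x y e e0 hxM hyM hxy.
apply: (le_trans hd).
apply: (@le_trans _ _ (4 * M / c ^+ 2 * e * (c / 2 * (c / 2)))).
  have -> : 4 * M / c ^+ 2 * e * (c / 2 * (c / 2)) = M * e by field; rewrite gt_eqF.
  by [].
apply: ler_pM.
- by rewrite mulr_ge0.
- by rewrite mulr_ge0// divr_ge0// ltW.
- by apply: ler_wpM2r => //; rewrite /D; lra.
- by apply: ler_pM; rewrite ?far// divr_ge0// ltW.
Qed.

End LocLipschitz.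

(** The states of all nodes, from the family of all their coordinates. *)
Definition states {R : realType} {n d : nat} (x : 'I_n * 'I_d -> R)
  (i : 'I_n) : 'cV[R]_d := \col_k x (i, k).

Lemma lifted_field_loc_lipschitz {R : realType} {n d : nat}
    (f : 'I_n -> 'I_n -> R -> R) (N : 'I_n -> {set 'I_n})
    (p : 'I_n * 'I_d -> R) (ik : 'I_n * 'I_d) :
  weights f -> (forall i, states p i != 0) ->
  loc_lipschitz p (fun x => lifted_field f N (states x) ik.1 ik.2 0).
Proof.
case: ik => i k /= fw p0.
have [L L0 fL] := weights_lipschitz _ fw.
have coordl j l : loc_lipschitz p (fun x => states x j l 0).
  under eq_fun do rewrite mxE; exact: loc_lipschitz_coord.
have norml j : loc_lipschitz p (fun x => euclid_norm (states x j)).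
  apply: (loc_lipschitz_euclid_norm _ _ (fun k x => x (j, k))) => l.
  exact: loc_lipschitz_coord.
have norm0 j : euclid_norm (states p j) != 0 by rewrite gt_eqF// euclid_norm_gt0.
have unitl j l : loc_lipschitz p (fun x => unit_vec (states x j) l 0).
  under eq_fun do rewrite mxE.
  by apply: loc_lipschitzM => //; exact: loc_lipschitzV.
pose y j (x : 'I_n * 'I_d -> R) := unit_vec (states x j).
have distl j : loc_lipschitz p (fun x => euclid_norm (y j x - y i x)).
  have -> : (fun x => euclid_norm (y j x - y i x))
    = (fun x => euclid_norm (\col_l (y j x l 0 - y i x l 0))).
    apply: funext => x; congr euclid_norm; apply/matrixP => l c.
    by rewrite ord1 [RHS]mxE [LHS]mxE [X in _ + X = _]mxE.
  apply: (loc_lipschitz_euclid_norm _ _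
    (fun l x => y j x l 0 - y i x l 0)) => l.
  exact: (loc_lipschitzB _ _ _ (unitl j l) (unitl i l)).
under eq_fun do rewrite summxE.
apply: (loc_lipschitz_sum _ _ _ (fun j x => _)) => j.
under eq_fun do rewrite mxE.
apply: loc_lipschitzM.
  apply: loc_lipschitzM.
    exact: (loc_lipschitz_comp p (f i j) _ L L0 (fL i j) (distl j)).
  by apply: loc_lipschitzM => //; exact: loc_lipschitzV.
under eq_fun do rewrite !mxE.
by apply: loc_lipschitzB; exact: loc_lipschitz_coord.
Qed.

(** * Continuation of solutions *)

Lemma deriv_within_quadratic {R : realType} (A : set R) (u : R -> R) (t v C : R) :
  (\forall s \near within A t^', `|u s - u t - (s - t) * v| <= C * (s - t) ^+ 2) ->
  deriv_within A u t v.
Proof.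
move=> h; apply/cvgrPdist_lt => e e0.
have D0 : 0 < `|C| + 1 by rewrite ltr_wpDl.
have : \forall s \near within A t^', `|s - t| < e / (`|C| + 1).
  have h' : \forall s \near t, `|t - s| < e / (`|C| + 1).
    apply: (@cvgr_dist_lt _ _ _ (nbhs t) _ id t (@cvg_id _ _)).
    exact: divr_gt0.
  rewrite near_withinE; apply: nbhs_dnbhs; apply: filterS h' => s.
  by rewrite distrC.
have : \forall s \near within A t^', s != t.
  by rewrite near_withinE; apply: filterS (nbhs_dnbhs_neq t) => s st _.
apply: filterS3 h => s hs st sd.
have st0 : s - t != 0 by rewrite subr_eq0.
have -> : v - (s - t)^-1 * (u s - u t) = - ((s - t)^-1 * (u s - u t - (s - t) * v)).
  by field.
rewrite normrN normrM normfV ltr_pdivrMl ?normr_gt0//.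
apply: (le_lt_trans hs); apply: (@le_lt_trans _ _ (`|s - t| * (`|C| * `|s - t|))).
  rewrite [leRHS]mulrCA -[X in _ <= _ * X]expr2 real_normK ?num_real//.
  by apply: ler_wpM2r; [exact: sqr_ge0|exact: ler_norm].
rewrite ltr_pM2l ?normr_gt0//.
rewrite ltr_pdivlMr// in sd.
have := normr_ge0 (s - t); have := normr_ge0 C; nra.
Qed.

Lemma is_derive_two_sided {R : realType} (u : R -> R) (t v : R) :
  deriv_within [set s | s <= t] u t v -> deriv_within [set s | t <= s] u t v ->
  is_derive t (1 : R) u v.
Proof.
move=> dl dr; apply/(deriv_within_interior setT); first exact: filterT.
apply/cvgrPdist_lt => e e0.
have hl : \forall s \near within [set s | s <= t] t^', 
    `|v - (s - t)^-1 * (u s - u t)| < e by move/cvgrPdist_lt: dl; exact.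
have hr : \forall s \near within [set s | t <= s] t^', 
    `|v - (s - t)^-1 * (u s - u t)| < e by move/cvgrPdist_lt: dr; exact.
move: hl hr; rewrite !near_withinE; apply: filterS2 => s /= h1 h2 st _.
by case: (leP s t) => [sl|/ltW sl]; [exact: h1|exact: h2].
Qed.

Lemma is_derive_cvg {R : realType} (u : R -> R) (t v : R) :
  is_derive t (1 : R) u v -> u s @[s --> t] --> u t.
Proof.
move=> du; apply: differentiable_continuous; apply/derivable1_diffP.
exact: ex_derive.
Qed.

(** A limit of the derivative is a one-sided derivative. *)
Lemma left_derivative_limit {R : realType} (u du : R -> R) (b v : R) :
  (\forall s \near b^'-, is_derive s (1 : R) u (du s)) ->
  u s @[s --> b^'-] --> u b -> du s @[s --> b^'-] --> v ->
  deriv_within [set s | s <= b] u b v.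
Proof.
move=> ud ub dv; apply/cvgrPdist_lt => e e0.
have dv' : \forall s \near b^'-, `|v - du s| < e.
  by move/cvgrPdist_lt: dv; exact.
have : \forall s \near b^'-, is_derive s (1 : R) u (du s) /\ `|v - du s| < e.
  by apply: filterS2 ud dv'.
rewrite /at_left near_withinE => /nbhs_ballP[D /= D0 hD].
rewrite near_withinE; have : \forall s \near b^', ball b D s.
  by apply: nbhs_dnbhs; exact: nbhsx_ballx.
have : \forall s \near b^', s != b by exact: nbhs_dnbhs_neq.
apply: filterS2 => s sb bs sb'.
have {sb sb'}sb : s < b by rewrite lt_neqAle sb.
have near_b c : s <= c -> c < b ->
    is_derive c (1 : R) u (du c) /\ `|v - du c| < e.
  move=> sc cb; apply: hD => //; move: bs.
  rewrite /ball/= !ltr_norml => /andP[h1 h2].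
  by apply/andP; split; lra.
have [c||c] := @MVT _ u du s b sb.
- by rewrite in_itv/= => /andP[sc cb]; have [] := near_b c (ltW sc) cb.
- apply/continuous_within_itvP => //; split=> [c||//].
    rewrite in_itv/= => /andP[sc cb].
    by have [/is_derive_cvg] := near_b c (ltW sc) cb.
  have [/is_derive_cvg us _] := near_b s (lexx s) sb.
  exact: cvg_at_right_filter.
rewrite in_itv/= => /andP[sc cb] uE.
have [_ h] := near_b c (ltW sc) cb.
have sb0 : s - b != 0 by rewrite subr_eq0 lt_eqF.
have -> : u s - u b = - (du c * (b - s)) by rewrite -uE opprB.
by have -> // : (s - b)^-1 * - (du c * (b - s)) = du c by field.
Qed.

(** A trajectory of a locally Lipschitz autonomous system that has a limit [l] at
    the end [b] of its interval can be continued past [b]. If the trajectory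
    satisfies the equation just before [b], its continuation satisfies it at [b]
    as well; otherwise [b] may be a switching time. *)
Lemma trajectory_extension {R : realType} {J : finType} (G : J -> (J -> R) -> R)
    (b : R) (x : J -> R -> R) (l : J -> R) :
  (forall j, x j s @[s --> b^'-] --> l j) ->
  (forall j, loc_lipschitz l (G j)) ->
  exists (e : R) (w : J -> R -> R), [/\ 0 < e,
    forall j s, s < b -> w j s = x j s,
    forall j, w j s @[s --> b] --> w j b,
    forall j t, b < t -> t < b + e -> is_derive t (1 : R) (w j) (G j (w^~ t)) &
    (forall j, \forall s \near b^'-, is_derive s (1 : R) (x j) (G j (x^~ s))) ->
    forall j, is_derive b (1 : R) (w j) (G j (w^~ b))].
Proof.
move=> xl Gl.
have [M M0 GM] : exists2 M : R, 0 < M & forall i x y e, 0 <= e ->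
    (forall j, `|x j - l j| <= M^-1) -> (forall j, `|y j - l j| <= M^-1) ->
    (forall j, `|x j - y j| <= e) -> `|G i x - G i y| <= M * e.
  have /choice[m mP] i : exists m, 0 < m /\ forall x y e, 0 <= e ->
      (forall j, `|x j - l j| <= m^-1) -> (forall j, `|y j - l j| <= m^-1) ->
      (forall j, `|x j - y j| <= e) -> `|G i x - G i y| <= m * e.
    by have [m m0 h'] := Gl i; exists m.
  have m0 i : 0 < m i by have [] := mP i.
  have S0 : 0 <= \sum_i m i by apply: sumr_ge0 => i _; exact: ltW.
  have mS i : m i <= 1 + \sum_i m i.
    rewrite (bigD1 i)//= addrCA lerDl addr_ge0//.
    by apply: sumr_ge0 => j _; exact: ltW.
  exists (1 + \sum_i m i); first by rewrite ltr_wpDr.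
  move=> i u y e e0 hu hy huy.
  have mi : (1 + \sum_i m i)^-1 <= (m i)^-1 by rewrite lef_pV2 ?posrE// ltr_wpDr.
  apply: (@le_trans _ _ (m i * e)); last by apply: ler_wpM2r.
  by have [_] := mP i; apply => // j; exact: le_trans mi.
have r0 : 0 < M^-1 by rewrite invr_gt0.
(* Composed with the projection on a box around l, the field is Lipschitz and
   bounded everywhere. *)
pose cl (u : J -> R) j := clamp (l j - M^-1) (l j + M^-1) (u j).
have clP u j : `|cl u j - l j| <= M^-1.
  have /andP[h1 h2] : l j - M^-1 <= cl u j <= l j + M^-1.
    by apply: clamp_in_segment; lra.
  by rewrite ler_norml; apply/andP; split; lra.
have clE u : (forall j, `|u j - l j| <= M^-1) -> cl u = u.
  move=> hu; apply: funext => j; apply: clamp_id.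
  by have := hu j; rewrite ler_norml => /andP[? ?]; apply/andP; split; lra.
pose K := \sum_j `|G j l| + 1.
have K0 : 0 < K by rewrite ltr_wpDl// sumr_ge0.
have Gclip i u y e : (forall j, `|u j - y j| <= e) ->
    `|G i (cl u) - G i (cl y)| <= M * e.
  move=> h; apply: GM => // [|j]; first exact: le_trans (normr_ge0 _) (h i).
  exact: le_trans (clamp_dist _ _ _ _) (h j).
have Gcbd i u : `|G i (cl u)| <= K.
  have h : `|G i (cl u) - G i l| <= M * M^-1.
    apply: GM => //; first exact: ltW.
    by move=> j; rewrite subrr normr0 ltW.
  rewrite mulfV ?gt_eqF// in h.
  have : `|G i l| <= \sum_j `|G j l| by rewrite (bigD1 i)//= lerDl sumr_ge0.
  have := ler_normD (G i (cl u) - G i l) (G i l); rewrite subrK /K; lra.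
have [e1 [X [e10 Xb XP]]] := picard (fun i u => G i (cl u)) M K b l
  (ltW M0) (ltW K0) Gclip Gcbd.
pose K' := K + M * (K * e1).
have K'0 : 0 < K' by rewrite addr_gt0// !mulr_gt0.
have Xlip i t : b <= t -> t <= b + e1 -> `|X i t - l i| <= (t - b) * K'.
  move=> bt te; have h := XP i b b t (lexx b) (lexx b) bt te.
  rewrite Xb in h; have tb : 0 <= t - b by lra.
  have h2 : `|(t - b) * G i (cl (X^~ b))| <= (t - b) * K.
    by rewrite normrM ger0_norm//; apply: ler_wpM2l.
  have h3 : (t - b) * (M * (K * (t - b))) <= (t - b) * (M * (K * e1)).
    apply: ler_wpM2l => //; apply: ler_wpM2l; first exact: ltW.
    by apply: ler_wpM2l; [exact: ltW|lra].
  have := ler_normD (X i t - l i - (t - b) * G i (cl (X^~ b)))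
    ((t - b) * G i (cl (X^~ b))).
  by rewrite subrK /K' mulrDr; lra.
(* The solution does not leave the box before the time b + e. *)
pose e := Num.min e1 (M^-1 / K').
have e0 : 0 < e by rewrite lt_min e10 divr_gt0.
have ee1 : e <= e1 by rewrite ge_min lexx.
have Xin t : b <= t -> t <= b + e -> cl (X^~ t) = X^~ t.
  move=> bt te; apply: clE => j; apply: (le_trans (Xlip j t bt _)); first lra.
  rewrite -ler_pdivlMr//; have : e <= M^-1 / K' by rewrite ge_min lexx orbT.
  lra.
pose w j t := if t < b then x j t else X j t.
have wx j s : s < b -> w j s = x j s by rewrite /w => ->.
have wX j s : b <= s -> w j s = X j s by rewrite /w leNgt => /negbTE ->.
have wb : w^~ b = l by apply: funext => j; rewrite wX.
have quad j s t : b <= s -> b <= t -> s <= b + e -> t <= b + e ->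
    `|X j s - X j t - (s - t) * G j (X^~ t)| <= M * K * (s - t) ^+ 2.
  move=> bs bt se te; rewrite -(Xin t)//.
  have -> : M * K * (s - t) ^+ 2 = (s - t) * (M * (K * (s - t))) by ring.
  case: (leP t s) => [ts|/ltW st]; first by apply: XP => //; lra.
  have -> : X j s - X j t - (s - t) * G j (cl (X^~ t))
    = - (X j t - X j s - (t - s) * G j (cl (X^~ t))) by ring.
  have -> : (s - t) * (M * (K * (s - t))) = (t - s) * (M * (K * (t - s))) by ring.
  by rewrite normrN; apply: XP => //; lra.
have wright j : deriv_within [set s | b <= s] (w j) b (G j l).
  apply: (deriv_within_quadratic _ _ _ _ (M * K)).
  rewrite near_withinE; apply: nbhs_dnbhs.
  have : \forall s \near b, s < b + e by apply: lt_nbhsl; lra.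
  apply: filterS => s sb /= bs; rewrite !wX//.
  have -> : l = X^~ b by apply: funext => k; rewrite Xb.
  apply: quad; lra.
have wleft j : w j s @[s --> b^'-] --> w j b.
  rewrite wX// Xb; apply: cvg_trans (xl j); apply: near_eq_cvg.
  by rewrite /at_left near_withinE; apply: filterE => s sb; rewrite wx.
exists e, w; split=> // [j|j t bt tbe|xd j].
- apply/left_right_continuousP; split=> //.
  have sub : b^'+ --> within [set s | b <= s] b^'.
    move=> A A0; have hA : \forall s \near b, s != b -> b <= s -> A s by [].
    have : \forall s \near b, b < s -> A s; last by [].
    by apply: filterS hA => s h bs; apply: h; [rewrite gt_eqF|exact: ltW].
  have := deriv_within_cvg _ _ _ _ (wright j); apply: cvg_trans.
  exact: cvg_app.
- apply: (@near_eq_is_derive _ _ _ (X j)).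
    have : \forall s \near t, b < s by exact: lt_nbhsr.
    by apply: filterS => s bs; rewrite wX ?ltW.
  have -> : w^~ t = X^~ t by apply: funext => k; rewrite wX ?ltW.
  apply/(deriv_within_interior setT); first exact: filterT.
  apply: (deriv_within_quadratic _ _ _ _ (M * K)).
  rewrite near_withinE; apply: nbhs_dnbhs.
  have : \forall s \near t, b < s by exact: lt_nbhsr.
  have : \forall s \near t, s < b + e by exact: lt_nbhsl.
  apply: filterS2 => s sb bs _; apply: quad; lra.
rewrite wb; apply: is_derive_two_sided => //.
apply: (left_derivative_limit _ (fun s => G j (x^~ s))) => //.
  have : \forall s \near b^'-, s < b by exact: nbhs_left_lt.
  apply: filterS2 (xd j) => s xs sb.
  apply: (near_eq_is_derive _ xs).
  have : \forall r \near s, r < b by exact: lt_nbhsl.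
  by apply: filterS => r rb; rewrite wx.
apply/cvgrPdist_le => d d0; pose q := Num.min M^-1 (d / M).
have q0 : 0 < q by rewrite lt_min r0 divr_gt0.
have : \forall s \near b^'-, forall k, `|l k - x k s| <= q.
  by apply: filter_forall => k; move/cvgrPdist_le: (xl k); exact.
apply: filterS => s hs.
have qd : M * q <= d by rewrite mulrC -ler_pdivlMr// ge_min lexx orbT.
apply: (le_trans _ qd); apply: GM => //; first exact: ltW.
  by move=> k; rewrite subrr normr0 ltW.
by move=> k; rewrite distrC; apply: (le_trans (hs k)); rewrite ge_min lexx.
Qed.

(** * Norms and directions along a trajectory *)

Lemma has_derivative_within_dotv {R : realType} {d : nat} (A : set R)
    (x : R -> 'cV[R]_d) (t : R) (v : 'cV[R]_d) :
  has_derivative_within A x t v ->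
  deriv_within A (fun s => dotv (x s) (x s)) t (2 * dotv (x t) v).
Proof.
move=> /has_derivative_withinP xd.
have -> : 2 * dotv (x t) v = \sum_k (v k 0 * x t k 0 + x t k 0 * v k 0).
  by rewrite mulr_sumr; apply: eq_bigr => k _; ring.
by apply: deriv_within_sum => k; exact: deriv_withinM.
Qed.

Lemma cvg_dotv {R : realType} {d : nat} {T : Type} (F : set_system T)
    (FF : Filter F) (x : T -> 'cV[R]_d) (v : 'cV[R]_d) :
  x s @[s --> F] --> v -> dotv (x s) (x s) @[s --> F] --> dotv v v.
Proof.
move=> /cvg_mxP xv.
by apply: cvg_big => [|k _]; [exact: add_continuous|apply: cvgM; exact: xv].
Qed.

Lemma cvg_unit_vec {R : realType} {d : nat} {T : Type} (F : set_system T)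
    (FF : Filter F) (x : T -> 'cV[R]_d) (v : 'cV[R]_d) :
  v != 0 -> x s @[s --> F] --> v -> unit_vec (x s) @[s --> F] --> unit_vec v.
Proof.
move=> v0 xv; apply/cvg_mxP => k j; rewrite ord1 mxE; under eq_fun do rewrite mxE.
apply: cvgM; last by move/cvg_mxP: xv; exact.
apply: cvgV; first by rewrite gt_eqF// euclid_norm_gt0.
under eq_fun do rewrite euclid_normE; rewrite euclid_normE.
exact: (cvg_comp _ _ (cvg_dotv F FF _ _ xv) (@sqrt_continuous _ _)).
Qed.

(** The part of [w] orthogonal to the unit vector [y]. *)
Definition tangent {R : realType} {d : nat} (y w : 'cV[R]_d) : 'cV[R]_d :=
  w - dotv y w *: y.

Lemma has_derivative_within_unit_vec {R : realType} {d : nat} (A : set R)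
    (x : R -> 'cV[R]_d) (t : R) (v : 'cV[R]_d) :
  x t != 0 -> has_derivative_within A x t v ->
  has_derivative_within A (fun s => unit_vec (x s)) t
    (tangent (unit_vec (x t)) ((euclid_norm (x t))^-1 *: v)).
Proof.
move=> x0 xd; apply/has_derivative_withinP => k.
have r0 : 0 < euclid_norm (x t) by rewrite euclid_norm_gt0.
have rd : deriv_within A (fun s => euclid_norm (x s)) t
    (2 * dotv (x t) v / (2 * euclid_norm (x t))).
  under eq_fun do rewrite euclid_normE; rewrite euclid_normE.
  by apply: deriv_within_sqrt; [rewrite dotvv_gt0|exact: has_derivative_within_dotv].
have rVd := deriv_withinV _ (fun s => euclid_norm (x s)) _ _ (lt0r_neq0 r0) rd.
have xkd := (has_derivative_withinP _ _ _ _).1 xd k.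
under eq_fun do rewrite mxE.
have := deriv_withinM _ (fun s => (euclid_norm (x s))^-1) _ _ _ _ rVd xkd.
congr (deriv_within _ _ _ _).
rewrite !mxE dotvZr dotvZl; field; exact: lt0r_neq0.
Qed.

(** The quotients of norms in the lifted field affect only the component along
    the direction of the node, which the projection removes. *)
Lemma sphere_field_unit_vec {R : realType} {n d : nat} (f : 'I_n -> 'I_n -> R -> R)
    (N : 'I_n -> {set 'I_n}) (z : 'I_n -> 'cV[R]_d) (i : 'I_n) :
  (forall j, z j != 0) ->
  tangent (unit_vec (z i)) ((euclid_norm (z i))^-1 *: lifted_field f N z i)
  = sphere_field f N (fun j => unit_vec (z j)) i.
Proof.
move=> z0; set y := fun j => unit_vec (z j); set r := fun j => euclid_norm (z j).
have r0 j : r j != 0 by rewrite gt_eqF// euclid_norm_gt0.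
rewrite /sphere_field -/(y i) mulmxBl mul1mx mulmx_tr_dotv.
set S := \sum_(j in N i) _.
have -> : (r i)^-1 *: lifted_field f N z i = S + (\sum_(j in N i)
    f i j (euclid_norm (y j - y i)) * (1 - r i / r j)) *: y i.
  rewrite scaler_suml -big_split scaler_sumr; apply: eq_bigr => j _ /=.
  apply/matrixP => k c; rewrite ord1 !mxE -/(r i) -/(r j); field.
  by rewrite !r0.
have yy : dotv (y i) (y i) = 1.
  by rewrite -sqr_euclid_norm euclid_norm_unit_vec// expr1n.
rewrite /tangent dotvDr dotvZr yy mulr1 scalerDl opprD addrACA.
by rewrite subrr addr0.
Qed.

Section Solution.
Context {R : realType} {n d : nat}.
Variables (f : 'I_n -> 'I_n -> R -> R) (N : 'I_n -> R -> {set 'I_n}).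
Variables (b : \bar R) (z : 'I_n -> R -> 'cV[R]_d).
Hypothesis fw : weights f.
Hypothesis tvN : time_varying_neighborhoods N.
Hypothesis zsol : solution N (lifted_field f) b z.
Hypothesis z_init : forall i, z i 0 != 0.

Let rho i t := dotv (z i t) (z i t).
Let F i t := lifted_field f (N^~ t) (z^~ t) i.

Lemma solution_cvg i t : time_interval b t ->
  z i s @[s --> within (time_interval b) (nbhs t)] --> z i t.
Proof. by have [_ zc _] := zsol; have /subspace_continuousP := zc i; apply. Qed.

Lemma solution_cvg_interior i t : 0 < t -> time_interval b t ->
  z i s @[s --> t] --> z i t.
Proof.
move=> t0 tb; have := solution_cvg i t tb; apply: cvg_trans; apply: cvg_app.
move=> A A0; have hA : \forall s \near t, time_interval b s -> A s by [].
have tn : \forall s \near t, time_interval b s by exact: time_interval_nbhs.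
by have : \forall s \near t, A s by apply: filterS2 tn hA => s h; apply.
Qed.

Lemma sqr_norm_continuous i : {within time_interval b, continuous (rho i)}.
Proof.
by apply/subspace_continuousP => t tb; apply: cvg_dotv; exact: solution_cvg.
Qed.

Lemma sqr_norm_derive i t : 0 < t -> time_interval b t -> ~ switching_time N t ->
  is_derive t (1 : R) (rho i) (2 * dotv (z i t) (F i t)).
Proof.
move=> t0 tb tN; apply/(deriv_within_interior (time_interval b)).
  exact: time_interval_nbhs.
by apply: has_derivative_within_dotv; have [_ _ zd] := zsol; exact: zd.
Qed.

Lemma exp_sqr_norm_derive (C : R) i t :
  0 < t -> time_interval b t -> ~ switching_time N t ->
  is_derive t (1 : R) (fun s => rho i s * expR (C * s))
    ((2 * dotv (z i t) (F i t) + C * rho i t) * expR (C * t)).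
Proof.
move=> t0 tb tN; have rd := sqr_norm_derive i t t0 tb tN.
have ed : is_derive t (1 : R) (fun s => expR (C * s)) (C * expR (C * t)).
  have ld : is_derive t (1 : R) (fun s => C * s) C.
    by apply: is_derive_eq; rewrite /GRing.scale/= ?mulr1 ?mulr0 ?addr0 ?add0r.
  by have := is_derive1_comp (is_derive_expR (C * t)) ld; rewrite mulrC.
apply: (is_derive_eq (is_deriveM rd ed)).
rewrite /GRing.scale/=; ring.
Qed.

Lemma exp_sqr_norm_continuous (C : R) i :
  {within time_interval b, continuous (fun s => rho i s * expR (C * s))}.
Proof.
apply/subspace_continuousP => t tb; apply: cvgM.
  by have /subspace_continuousP := sqr_norm_continuous i; exact.
apply: cvg_within_filter.
have h : C * s @[s --> t] --> C * t by apply: cvgMr; exact: cvg_id.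
exact: (cvg_comp _ _ h (@continuous_expR _ _)).
Qed.

Lemma regular_before t : 0 < t -> (t%:E <= b)%E ->
  \forall s \near t^'-, [/\ 0 < s, time_interval b s & ~ switching_time N s].
Proof.
move=> t0 tb.
have h1 : \forall s \near t^'-, s < t by exact: nbhs_left_lt.
have h2 : \forall s \near t^'-, 0 < s by exact: nbhs_left_gt.
have h3 : \forall s \near t^'-, ~ switching_time N s.
  have : \forall s \near t^', ~ switching_time N s by exact: switching_time_isolated.
  rewrite /at_left /dnbhs !near_withinE; apply: filterS => s h st.
  by apply: h; rewrite lt_eqF.
apply: filterS3 h1 h2 h3 => s st s0 sN; split=> //; split; first exact: ltW.
by apply: lt_le_trans tb; rewrite lte_fin.
Qed.

Let le_time_interval t : time_interval b t -> (t%:E <= b)%E.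
Proof. by move=> [_ /ltW]. Qed.

Let segment_interval t : time_interval b t -> `[0, t] `<=` time_interval b.
Proof.
move=> tb s /=; rewrite in_itv/= => /andP[s0 st]; exact: time_interval_le st tb.
Qed.

(** No node reaches the origin: the smallest norm decays at most exponentially. *)
Lemma norm_lower : exists (c C : R), [/\ 0 < c, 0 <= C
  & forall i t, time_interval b t -> c < rho i t * expR (C * t)].
Proof.
have [M M0 fM] := weights_bounded _ fw.
(* The factor 6 is twice the constant 3 of the inward speed bound, because rho is
   the squared norm; adding 1 makes the weighted norm strictly increasing. *)
pose C := 6 * (n%:R * M) + 1.
have nM : 0 <= n%:R * M by rewrite mulr_ge0.
have C0 : 0 <= C by rewrite /C; lra.
have [c c0 cz] : exists2 c, 0 < c & forall i, c < rho i 0.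
  have : \forall c \near 0^'+, forall i, c < rho i 0.
    apply: filter_forall => i; apply: nbhs_right_lt.
    by rewrite dotvv_gt0.
  move=> h; have : \forall c \near 0^'+, 0 < c /\ forall i, c < rho i 0.
    by apply: filterS2 h (nbhs_right_gt 0) => c h1 h2; split.
  by move=> /filter_ex[c [h1 h2]]; exists c.
exists c, C; split=> //.
apply: first_passage => [i|i|i t t0 tb qc qi].
- exact: exp_sqr_norm_continuous.
- by rewrite mulr0 expR0 mulr1.
have rho0 j : 0 < rho j t.
  by rewrite -(pmulr_lgt0 _ (expR_gt0 (C * t))); exact: lt_le_trans (qc j).
(* At time t node i has the smallest norm, and just before t its norm is at most
   twice that of any other node. *)
have rhoij j : rho i t <= rho j t.
  by rewrite -(ler_pM2r (expR_gt0 (C * t))) qi.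
have rcont j : rho j s @[s --> t] --> rho j t.
  by apply: cvg_dotv; exact: solution_cvg_interior.
rewrite -qi; apply: (smaller_before _
    (fun s => (2 * dotv (z i s) (F i s) + C * rho i s) * expR (C * s))) => //.
  apply: continuous_subspaceW (exp_sqr_norm_continuous C i).
  exact: segment_interval.
have pos : \forall s \near t^'-, forall j, 0 < rho j s.
  apply: filter_forall => j.
  exact: cvgr_gt _ (cvg_at_left_filter (rcont j)) _ (rho0 j).
have cmp : \forall s \near t^'-, forall j, rho i s < 4 * rho j s.
  apply: filter_forall => j.
  have h : 4 * rho j s - rho i s @[s --> t] --> 4 * rho j t - rho i t.
    by apply: cvgB => //; exact: cvgMr.
  have h0 : 0 < 4 * rho j t - rho i t by have := rho0 j; have := rhoij j; lra.
  have : \forall s \near t^'-, 0 < 4 * rho j s - rho i s.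
    exact: cvgr_gt _ (cvg_at_left_filter h) _ h0.
  by apply: filterS => s; rewrite subr_gt0.
have reg := regular_before t t0 (le_time_interval _ tb).
apply: filterS3 pos cmp reg => s s_pos s_cmp [s0 sb sN].
split; first exact: exp_sqr_norm_derive.
rewrite pmulr_lgt0 ?expR_gt0//.
have zs0 j : z j s != 0 by rewrite -dotvv_gt0; exact: s_pos.
have := lifted_field_lower f M fM (N^~ s) (z^~ s) i zs0.
have r2 j : euclid_norm (z i s) <= 2 * euclid_norm (z j s).
  rewrite -ler_sqr ?nnegrE ?mulr_ge0 ?euclid_norm_ge0// exprMn !sqr_euclid_norm.
  by have := s_cmp j; rewrite /rho; lra.
move=> /(_ r2); rewrite -/(F i s) -/(rho i s) /C; have := s_pos i.
nra.
Qed.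

Lemma solution_neq0 i t : time_interval b t -> z i t != 0.
Proof.
move=> tb; have [c [C [c0 _ h]]] := norm_lower.
rewrite -dotvv_gt0 -(pmulr_lgt0 _ (expR_gt0 (C * t))).
exact: lt_trans (h i t tb).
Qed.

(** The largest norm grows at most exponentially. *)
Lemma norm_upper : exists (Q C : R), [/\ 0 < Q, 0 <= C
  & forall i t, time_interval b t -> rho i t * expR (- C * t) < Q].
Proof.
have [M M0 fM] := weights_bounded _ fw.
(* Twice the constant of the outward speed bound, plus 1 for strictness. *)
pose C := 2 * (n%:R * M) + 1.
have nM : 0 <= n%:R * M by rewrite mulr_ge0.
have C0 : 0 <= C by rewrite /C; lra.
have Q0 : 0 <= \sum_i rho i 0 by apply: sumr_ge0 => i _; exact: dotvv_ge0.
pose Q := \sum_i rho i 0 + 1; exists Q, C; split=> // [|i t tb].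
  by rewrite ltr_wpDl.
rewrite -ltrN2; move: i t tb.
apply: (first_passage _ (fun i t => - (rho i t * expR (- C * t))))
  => [i|i|i t t0 tb qc qi].
- apply/subspace_continuousP => t tb; apply: cvgN.
  by have /subspace_continuousP := exp_sqr_norm_continuous (- C) i; exact.
- rewrite mulr0 expR0 mulr1 ltrN2 /Q (bigD1 i)//= -addrA ltrDl ltr_wpDl//.
  by apply: sumr_ge0 => j _; exact: dotvv_ge0.
rewrite -qi; apply: (smaller_before _
    (fun s => - ((2 * dotv (z i s) (F i s) + - C * rho i s) * expR (- C * s)))) => //.
  apply: (@continuous_subspaceW _ _ _ (time_interval b)).
    exact: segment_interval.
  apply/subspace_continuousP => r rb; apply: cvgN.
  by have /subspace_continuousP := exp_sqr_norm_continuous (- C) i; exact.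
apply: filterS (regular_before t t0 (le_time_interval _ tb)) => s [s0 sb sN].
split; first by apply: is_deriveN; exact: exp_sqr_norm_derive.
rewrite oppr_gt0 pmulr_llt0 ?expR_gt0//.
have zs0 j : z j s != 0 by exact: solution_neq0.
have := lifted_field_upper f M fM (N^~ s) (z^~ s) i zs0.
rewrite -/(F i s) -/(rho i s) /C.
have : 0 < rho i s by rewrite dotvv_gt0.
nra.
Qed.

Lemma unit_vec_solution :
  solution N (sphere_field f) b (fun i t => unit_vec (z i t)).
Proof.
have [b0 zc zd] := zsol; split=> // [i|i t tb tN].
  apply/subspace_continuousP => t tb.
  by apply: cvg_unit_vec; [exact: solution_neq0|exact: solution_cvg].
rewrite -sphere_field_unit_vec; last by move=> j; exact: solution_neq0.
by apply: has_derivative_within_unit_vec; [exact: solution_neq0|exact: zd].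
Qed.

End Solution.

(** * A maximal solution is global *)

(** A limit relative to [B] is a limit relative to [A] when, eventually, [A] is
    contained in [B] and the two functions agree on [A]. *)
Lemma cvg_within_local {T : Type} {U : topologicalType}
    (A B : set T) (F : set_system T) (FF : Filter F) (u w : T -> U) (l : U) :
  (\forall s \near F, A s -> B s /\ u s = w s) ->
  u s @[s --> within B F] --> l -> w s @[s --> within A F] --> l.
Proof.
move=> uw ul P Pl; have h : \forall s \near F, B s -> P (u s) := ul P Pl.
have : \forall s \near F, A s -> P (w s); last by [].
by apply: filterS2 uw h => s h1 h2 As; have [Bs <-] := h1 As; exact: h2.
Qed.

Lemma bounded_derivative_left_limit {R : realType} (u du : R -> R) (b K : R) :
  (\forall s \near b^'-, is_derive s (1 : R) u (du s) /\ `|du s| <= K) ->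
  exists l : R, u s @[s --> b^'-] --> l.
Proof.
rewrite /at_left near_withinE => /nbhs_ballP[D /= D0 hD].
have hd c : b - D < c < b -> is_derive c (1 : R) u (du c) /\ `|du c| <= K.
  move=> /andP[h1 h2]; apply: hD => //.
  by rewrite /ball/= ltr_norml; apply/andP; split; lra.
have K0 : 0 <= K.
  have hb : b - D < b - D / 2 < b by lra.
  by have [_ /(le_trans (normr_ge0 _))] := hd _ hb.
have ulip s t : b - D < s -> s <= t -> t < b -> `|u t - u s| <= K * (t - s).
  move=> Ds st tb.
  have hst r : s <= r <= t -> b - D < r < b by lra.
  have [r /hst/hd[]//|c /hst/hd[_ dc] ->] := derive_increment u du _ _ st.
  rewrite normrM ger0_norm ?subr_ge0// mulrC; apply: ler_wpM2r => //.
  by rewrite subr_ge0.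
have : cvg (u s @[s --> b^'-]).
  apply/cauchy_cvgP; apply: cauchy_exP => e e0.
  pose q := Num.min (D / 2) (e / (2 * (K + 1))).
  have K1 : 0 < 2 * (K + 1) by lra.
  have q0 : 0 < q by rewrite lt_min !divr_gt0.
  have qD : q <= D / 2 by rewrite ge_min lexx.
  have qe : q * (2 * (K + 1)) <= e by rewrite -ler_pdivlMr// ge_min lexx orbT.
  exists (u (b - q)).
  have h1 : \forall s \near b^'-, s < b by exact: nbhs_left_lt.
  have h2 : \forall s \near b^'-, b - q < s by apply: nbhs_left_gt; lra.
  apply: filterS2 h1 h2 => s sb qs; rewrite /ball/= distrC.
  apply: (le_lt_trans (ulip _ _ _ (ltW qs) sb)); first lra.
  nra.
by move=> /cvg_ex.
Qed.

Section FiniteEnd.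
Context {R : realType} {n d : nat}.
Variables (f : 'I_n -> 'I_n -> R -> R) (N : 'I_n -> R -> {set 'I_n}).
Variables (b : R) (z : 'I_n -> R -> 'cV[R]_d).
Hypothesis fw : weights f.
Hypothesis tvN : time_varying_neighborhoods N.
Hypothesis zsol : solution N (lifted_field f) b%:E z.
Hypothesis z_init : forall i, z i 0 != 0.

Lemma finite_end_gt0 : 0 < b.
Proof. by have [] := zsol; rewrite lte_fin. Qed.

Lemma norm_bounds : exists (m B : R), 0 < m /\
  forall i t, time_interval b%:E t -> m <= euclid_norm (z i t) <= B.
Proof.
have [c [C [c0 C0 lo]]] := norm_lower f N _ z fw tvN zsol z_init.
have [Q [D [Q0 D0 up]]] := norm_upper f N _ z fw tvN zsol z_init.
have bnd i t : time_interval b%:E t ->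
    c * expR (- (C * b)) <= dotv (z i t) (z i t) <= Q * expR (D * b).
  move=> tb; have [t0] := tb; rewrite lte_fin => /ltW tb'.
  apply/andP; split.
    have h := ltW (lo i t tb).
    rewrite expRN ler_pdivrMr ?expR_gt0//; apply: (le_trans h).
    by apply: ler_wpM2l; [exact: dotvv_ge0|rewrite ler_expR; apply: ler_wpM2l].
  have h := ltW (up i t tb).
  rewrite mulNr expRN ler_pdivrMr ?expR_gt0// in h; apply: (le_trans h).
  by apply: ler_wpM2l; [exact: ltW|rewrite ler_expR; apply: ler_wpM2l].
exists (Num.sqrt (c * expR (- (C * b)))), (Num.sqrt (Q * expR (D * b))).
split; first by rewrite sqrtr_gt0 mulr_gt0// expR_gt0.
move=> i t /(bnd i)/andP[h1 h2]; rewrite euclid_normE.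
by rewrite !ler_wsqrtr.
Qed.

Lemma coord_derive i k t : 0 < t -> time_interval b%:E t -> ~ switching_time N t ->
  is_derive t (1 : R) (fun s => z i s k 0) (lifted_field f (N^~ t) (z^~ t) i k 0).
Proof.
move=> t0 tb tN; apply/(deriv_within_interior (time_interval b%:E)).
  exact: time_interval_nbhs.
by have [_ _ zd] := zsol; have /has_derivative_withinP := zd i t tb tN; exact.
Qed.

(** The velocities are bounded, hence the states have limits at the end of the
    interval; these limits are again nonzero. *)
Lemma limit_at_end : exists l : 'I_n -> 'cV[R]_d,
  (forall i, z i s @[s --> b^'-] --> l i) /\ forall i, l i != 0.
Proof.
have [m [B [m0 mB]]] := norm_bounds.
have [M M0 fM] := weights_bounded _ fw.
have reg := regular_before N b%:E tvN b finite_end_gt0 (lexx _).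
have /choice[l lP] (ik : 'I_n * 'I_d) :
    exists l : R, z ik.1 s ik.2 0 @[s --> b^'-] --> l.
  apply: (bounded_derivative_left_limit _
    (fun s => lifted_field f (N^~ s) (z^~ s) ik.1 ik.2 0) _
    (n%:R * (M * (B / m) * (2 * B)))).
  apply: filterS reg => s [s0 sb sN]; split; first exact: coord_derive.
  apply: (lifted_field_coord f M fM) => // j; last exact: mB.
  exact: solution_neq0 fw tvN zsol z_init _ _ sb.
have zl i : z i s @[s --> b^'-] --> states l i.
  by apply/cvg_mxP => k j; rewrite ord1 mxE; exact: (lP (i, k)).
exists (states l); split=> // i; rewrite -euclid_norm_gt0.
have nl : euclid_norm (z i s) @[s --> b^'-] --> euclid_norm (states l i).
  under eq_fun do rewrite euclid_normE; rewrite euclid_normE.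
  exact: (cvg_comp _ _ (cvg_dotv _ _ _ _ (zl i)) (@sqrt_continuous _ _)).
apply: (lt_le_trans m0); rewrite -(cvg_lim (@Rhausdorff R) nl).
apply: limr_ge; first by apply/cvg_ex; eexists; exact: nl.
by apply: filterS reg => s [_ sb _]; have /andP[] := mB i s sb.
Qed.

(** A solution on a bounded interval is never maximal. *)
Lemma finite_end_extension : exists (c : R) (w : 'I_n -> R -> 'cV[R]_d),
  [/\ b < c, solution N (lifted_field f) c%:E w
    & forall i t, time_interval b%:E t -> w i t = z i t].
Proof.
have b0 := finite_end_gt0.
have [l [zl l0]] := limit_at_end.
pose p (ik : 'I_n * 'I_d) := l ik.1 ik.2 0.
pose G (ik : 'I_n * 'I_d) x := lifted_field f (N^~ b) (states x) ik.1 ik.2 0.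
pose x (ik : 'I_n * 'I_d) s := z ik.1 s ik.2 0.
have statesp i : states p i = l i.
  by apply/matrixP => k j; rewrite ord1 mxE.
have statesx t i : states (x^~ t) i = z i t.
  by apply/matrixP => k j; rewrite ord1 mxE.
have xp ik : x ik s @[s --> b^'-] --> p ik.
  by have /cvg_mxP := zl ik.1; exact.
have Gp ik : loc_lipschitz p (G ik).
  by apply: lifted_field_loc_lipschitz => // i; rewrite statesp.
have [e [w [e0 wx wb wd wdb]]] := trajectory_extension G b x p xp Gp.
pose W i t := states (w^~ t) i.
have Wz i t : t < b -> W i t = z i t.
  move=> tb; rewrite -statesx /W; congr (states _ i).
  by apply: funext => j; exact: wx.
(* After b the graph stays the same for some time. *)
have [c [bc ce cN]] : exists c, [/\ b < c, c <= b + e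
    & forall t, b < t -> t < c -> ~ switching_time N t /\ N^~ t = N^~ b].
  have hN : \forall t \near b^'+, N^~ t = N^~ b.
    have : \forall t \near b^'+, forall i, N i t = N i b.
      by apply: filter_forall => i; have [/(_ i)[_ +] _] := tvN; exact.
    by apply: filterS => t h; apply: funext.
  have hs : \forall t \near b^'+, ~ switching_time N t.
    have : \forall s \near b^', ~ switching_time N s.
      exact: switching_time_isolated.
    rewrite /at_right /dnbhs !near_withinE; apply: filterS => s h st.
    by apply: h; rewrite gt_eqF.
  have : \forall t \near b^'+, ~ switching_time N t /\ N^~ t = N^~ b.
    by apply: filterS2 hs hN.
  rewrite /at_right near_withinE => /nbhs_ballP[D /= D0 hD].
  exists (b + Num.min D e); split.
  - by rewrite ltrDl lt_min D0.
  - by rewrite lerD2l ge_min lexx orbT.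
  move=> t bt; rewrite -ltrBlDl lt_min => /andP[tD _]; apply: hD => //.
  by rewrite /ball/= ltr_norml; apply/andP; split; lra.
have wcont ik t : 0 < t -> t < c -> b <= t -> w ik s @[s --> t] --> w ik t.
  move=> t0 tc; rewrite le_eqVlt => /predU1P[<-//|bt].
  by apply: is_derive_cvg; apply: wd => //; lra.
exists c, W; split=> //; last by move=> i t [_]; rewrite lte_fin; exact: Wz.
split=> [|i|i t].
- by rewrite lte_fin (lt_trans b0).
- apply/subspace_continuousP => t [t0]; rewrite lte_fin => tc.
  case: (leP b t) => [bt|tb].
    apply: cvg_within_filter; apply/cvg_mxP => k j; rewrite ord1 mxE.
    under eq_fun do rewrite mxE.
    by apply: wcont => //; lra.
  suff : W i s @[s --> within (time_interval c%:E) (nbhs t)] --> W i t by [].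
  have tb' : time_interval b%:E t by split.
  rewrite Wz//; apply: (cvg_within_local _ (time_interval b%:E) _ _ (z i)); last first.
    exact: (solution_cvg f N _ z zsol i t tb').
  have : \forall s \near t, s < b by exact: lt_nbhsl.
  by apply: filterS => s sb [s0 _]; split; [split|rewrite Wz].
move=> [t0]; rewrite lte_fin => tc tN.
case: (ltP t b) => [tb|bt].
  have [_ _ zd] := zsol; have tb' : time_interval b%:E t by split.
  have -> : W^~ t = z^~ t by apply: funext => j; exact: Wz.
  apply: (cvg_within_local _ _ _ _ _ _ _ _ (zd i t tb' tN)).
  have : \forall s \near t^', s < b by apply: nbhs_dnbhs; exact: lt_nbhsl.
  by apply: filterS => s sb [s0 _]; split; [split|rewrite !Wz].
apply/has_derivative_withinP => k.
apply/deriv_within_interior.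
  by apply: time_interval_nbhs; [lra|split].
under eq_fun do rewrite mxE.
move: bt tN; rewrite le_eqVlt => /predU1P[<-{t t0 tc} bN|bt tN].
  apply: (wdb _ (i, k)) => ik.
  have hN : \forall s \near b^'-, N^~ s = N^~ b.
    have : \forall s \near b, forall j, N j s = N j b.
      apply: (@filter_forall _ _ (fun j s => N j s = N j b) (nbhs b)) => j.
      have [//|bj] := pselect (\forall s \near b, N j s = N j b).
      by case: bN; exists j.
    rewrite /at_left near_withinE; apply: filterS => s h _; exact: funext.
  have reg := regular_before N b%:E tvN b finite_end_gt0 (lexx _).
  apply: filterS2 hN reg => s sN [s0 sb ns].
  rewrite /G -sN (_ : states (x^~ s) = z^~ s); last first.
    by apply: funext => j; exact: statesx.
  exact: coord_derive.
have [_ ->] := cN t bt tc; apply: (wd (i, k)) => //; lra.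
Qed.

End FiniteEnd.

Theorem proposition3 (R : realType) (n d : nat)
    (f : 'I_n -> 'I_n -> R -> R) (N : 'I_n -> R -> {set 'I_n})
    (z0 : 'I_n -> 'cV[R]_d) (b : \bar R) (z : 'I_n -> R -> 'cV[R]_d) :
  (2 <= d)%N ->
  weights f ->
  time_varying_neighborhoods N ->
  uniformly_quasi_strongly_connected N ->
  maximal_solution N (lifted_field f) b z ->
  (forall i, z i 0 = z0 i) ->
  (forall i, z0 i != 0) ->
  [/\ b = +oo%E,
      forall i t, 0 <= t -> z i t != 0
    & solution N (sphere_field f) +oo%E (fun i t => unit_vec (z i t))].
Proof.
move=> _ fw tvN _ [zsol zmax] zz0 z00.
have z_init i : z i 0 != 0 by rewrite zz0.
have boo : b = +oo%E.
  case: b zsol zmax => [b||] zsol zmax //; last by have [] := zsol.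
  have [c [w [bc wsol wz]]] := finite_end_extension f N b z fw tvN zsol z_init.
  by have := zmax _ _ wsol wz; rewrite lee_fin leNgt bc.
rewrite {}boo in zsol zmax *; split=> //.
- move=> i t t0; apply: (solution_neq0 f N _ z fw tvN zsol z_init).
  by split; rewrite ?ltry.
- exact: unit_vec_solution.
Qed.
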